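(* For any algebraic structures $\mathbb{A}=\langle A;L(\mathbb{A})\rangle$ and $\mathbb{B}=\langle B;L(\mathbb{B})\rangle$ the following conditions are equivalent: (1) $\mathbb{A}$ and $\mathbb{B}$ are syntactically isomorphic; (2) $\mathcal{DS}(\mathbb{A})\simeq_{\mathbf{Tr}_{\mathrm{inj}}}\mathcal{DS}(\mathbb{B})$; (3) $\mathcal{LS}(\mathbb{A})\simeq_{\mathbf{Int}_{\mathrm{inj}}}\mathcal{LS}(\mathbb{B})$; (4) $\mathcal{PDS}(\mathbb{A})\simeq_{\mathbf{Tr}}\mathcal{PDS}(\mathbb{B})$; (5) $\mathcal{PLS}(\mathbb{A})\simeq_{\mathbf{Int}}\mathcal{PLS}(\mathbb{B})$.
   Context: **Structures and codes.** $\mathbb{A}=\langle A;L(\mathbb{A})\rangle$ denotes a first-order structure with non-empty underlying set $A$ in the language $L(\mathbb{A})$ (logic with equality; constant, function and predicate symbols); similarly for other letters. For $P\subseteq A$, $\mathbb{A}_P$ is the expansion of $\mathbb{A}$ by constants naming the elements of $P$. Maps are applied to tuples coordinatewise. An interpretation code $\Gamma\colon L(\mathbb{A})\to L(\mathbb{B})$ is a family of $L(\mathbb{B})$-formulas $U_\Gamma(\bar x,\bar y)$, $E_\Gamma(\bar x,\bar x',\bar y)$, $c_\Gamma(\bar x,\bar y)$, $f_\Gamma(\bar x_0,\bar x_1,\ldots,\bar x_{n_f},\bar y)$, $R_\Gamma(\bar x_1,\ldots,\bar x_{n_R},\bar y)$, one for each constant symbol $c$, function symbol $f$, predicate symbol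 $R$ of $L(\mathbb{A})$, where all tuples $\bar x,\bar x',\bar x_i$ have the same length $\dim\Gamma$ and $|\bar y|=\dim_{\mathrm{par}}\Gamma$. The code is injective if $E_\Gamma$ is the formula $\bar x=\bar x'$. For a tuple $\bar p$ from $B$ with $|\bar p|=\dim_{\mathrm{par}}\Gamma$ put $U_\Gamma(\mathbb{B},\bar p)=\{\bar b\mid\mathbb{B}\models U_\Gamma(\bar b,\bar p)\}$. The $L(\mathbb{A})$-structure $\Gamma(\mathbb{B},\bar p)$ is well-defined if $U_\Gamma(\mathbb{B},\bar p)\neq\emptyset$ and, on $U_\Gamma(\mathbb{B},\bar p)$, $E_\Gamma(\cdot,\cdot,\bar p)$ defines an equivalence relation $\sim_\Gamma$, each $c_\Gamma$ defines exactly one $\sim_\Gamma$-class, each $f_\Gamma$ defines (the preimage of) the graph $x_0=f(x_1,\ldots,x_{n_f})$ of an operation on $U_\Gamma(\mathbb{B},\bar p)/{\sim_\Gamma}$, and each $R_\Gamma$ defines (the preimage of) a relation on $U_\Gamma(\mathbb{B},\bar p)/{\sim_\Gamma}$; then $\Gamma(\mathbb{B},\bar p)$ is the resulting structure on $U_\Gamma(\mathbb{B},\bar p)/{\sim_\Gamma}$ (when $\sim_\Gamma$ is equality, $U/{\sim_\Gamma}$ is identified with $U$). An interpretation $(\Gamma,\bar p,\mu_\Gamma)\colon\mathbb{A}\rightsquigarrow\mathbb{B}$ consists of a code $\Gamma$, a tuple $\bar p$ such that $\Gamma(\mathbb{B},\bar p)$ is well-defined, and a surjection (coordinate map) $\mu_\Gamma\colon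 U_\Gamma(\mathbb{B},\bar p)\to A$ that induces an $L(\mathbb{A})$-isomorphism $\bar\mu_\Gamma\colon\Gamma(\mathbb{B},\bar p)\to\mathbb{A}$, $\bar\mu_\Gamma(\bar b/{\sim_\Gamma})=\mu_\Gamma(\bar b)$. **Translations.** A formula is in normal form if it is prenex and its matrix is a disjunction of conjunctions of unnested atomic formulas ($x=x'$, $x=c$, $f(x_1,\ldots,x_{n_f})=x_0$, $R(x_1,\ldots,x_{n_R})$) and their negations. For an $L(\mathbb{A})$-formula $\psi(x_1,\ldots,x_s)$ in normal form, $\psi_\Gamma(\bar x_1,\ldots,\bar x_s,\bar y)$ is the $L(\mathbb{B})$-formula obtained by replacing each variable by a tuple of $\dim\Gamma$ variables, replacing the unnested atomic formulas by $E_\Gamma,c_\Gamma,f_\Gamma,R_\Gamma$ respectively, relativizing all quantifiers to $U_\Gamma(\cdot,\bar y)$, and adding the conjuncts $U_\Gamma(\bar x_i,\bar y)$ for all listed free variables. A formula not in normal form is translated via a logically equivalent normal form. An extended code $(\Gamma,\bar p,\gamma)\colon L(\mathbb{A})\cup A\to L(\mathbb{B})\cup B$ consists of a code $\Gamma\colon L(\mathbb{A})\to L(\mathbb{B})$, a tuple $\bar p$ from $B$ with $|\bar p|=\dim_{\mathrm{par}}\Gamma$, and a map $\gamma\colon A\to B^{\dim\Gamma}$. For a formula $\psi(x_1,\ldots,x_m,a_1,\ldots,a_s)$ of $L(\mathbb{A})\cup A$ (with constants $a_i\in A$) put $\psi_{\Gamma,\bar p,\gamma}(\bar x_1,\ldots,\bar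 x_m)=\psi_\Gamma(\bar x_1,\ldots,\bar x_m,\gamma(a_1),\ldots,\gamma(a_s),\bar p)$, where $\psi_\Gamma$ is the translation of $\psi(x_1,\ldots,x_m,z_1,\ldots,z_s)$. **Projective logical geometry.** For a set $S$ of $L(\mathbb{A})\cup A$-formulas in free variables $x_1,\ldots,x_m$ put $\mathrm{V}_{\mathbb{A}}(S)=\{\bar a\in A^m\mid\mathbb{A}_A\models\psi(\bar a)\ \forall\psi\in S\}$. Sets $X=\mathrm{V}_{\mathbb{A}}(S)$ are the logical sets over $\mathbb{A}$; $X$ is an $(\alpha,\beta)$-logical set ($\alpha\leqslant\beta$ infinite cardinals; the symbol $\infty$ means no restriction) if $S$ can be chosen with $|S|<\beta$ and fewer than $\alpha$ parameters from $A$. The $(\omega,\omega)$-logical sets are the definable sets. An equivalence relation $\sim_X$ on a non-empty logical set $X\subseteq A^m$ is a formula equivalence, induced by an $L(\mathbb{A})\cup A$-formula $E(\bar x,\bar x')$, if for all $\bar a,\bar a'\in X$: $\bar a\sim_X\bar a'$ iff $\mathbb{A}_A\models E(\bar a,\bar a')$; and for all $\bar a\in X$, $\bar a'\in A^m$, $\mathbb{A}_A\models E(\bar a,\bar a')\vee E(\bar a',\bar a)$ implies $\bar a'\in X$. A projective logical set over $\mathbb{A}$ is a quotient $X/{\sim_X}$ of a non-empty logical set by a formula equivalence ($X$ is identified with $X/{=}$); it is an $(\alpha,\beta)$-projective logical set if $X$ is $(\alpha,\beta)$-logical, and a projective definable set if $X$ is definable. A map $F\colon X/{\sim_X}\to Y/{\sim_Y}$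 ($X\subseteq A^m$, $Y\subseteq A^s$) is a formula map, induced by an $L(\mathbb{A})\cup A$-formula $\varphi(\bar x,\bar y)$, if (I) for all $\bar a\in X,\bar b\in Y$: $F(\bar a/{\sim_X})=\bar b/{\sim_Y}$ iff $\mathbb{A}_A\models\varphi(\bar a,\bar b)$; (II) $\bar a\in X,\bar b\in A^s\setminus Y$ implies $\mathbb{A}_A\not\models\varphi(\bar a,\bar b)$. The category $\mathcal{PLS}(\mathbb{A})$ has as objects all projective logical sets over $\mathbb{A}$ and $\emptyset$; morphisms between non-empty objects are the formula maps; $\emptyset$ is an initial object and there are no morphisms from non-empty objects to $\emptyset$. $\mathcal{PLS}_{\alpha,\beta}(\mathbb{A})$ is the full subcategory of $(\alpha,\beta)$-projective logical sets (and $\emptyset$); $\mathcal{PDS}(\mathbb{A})=\mathcal{PLS}_{\omega,\omega}(\mathbb{A})$, $\mathcal{LS}(\mathbb{A})$, $\mathcal{DS}(\mathbb{A})$ are the full subcategories of projective definable sets, of logical sets, and of definable sets; $\mathcal{LS}_{\alpha,\beta}(\mathbb{A})$ is the full subcategory of $(\alpha,\beta)$-logical sets. **Translation and interpretation functors.** Let $(\Gamma,\bar p,\gamma)\colon L(\mathbb{A})\cup A\to L(\mathbb{B})\cup B$ be an extended code; for a set $S$ of formulas put $S_{\Gamma,\bar p,\gamma}=\{\psi_{\Gamma,\bar p,\gamma}\mid\psi\in S\}$. Consider the following conditions, where all systems $S,S',S_X,\ldots$ are non-empty sets of formulas in finitely many free variables, with fewer than $\beta$ formulas and fewer than $\alpha$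 parameters from $A$, and for $X=\mathrm{V}_{\mathbb{A}}(S_X)$ we write $\bar X=\mathrm{V}_{\mathbb{B}}((S_X)_{\Gamma,\bar p,\gamma})$ (conditions required for all choices of normal forms): (F1) $\mathrm{V}_{\mathbb{A}}(S)=\emptyset$ iff $\mathrm{V}_{\mathbb{B}}(S_{\Gamma,\bar p,\gamma})=\emptyset$; (F2) $\mathrm{V}_{\mathbb{A}}(S)=\mathrm{V}_{\mathbb{A}}(S')$ implies $\mathrm{V}_{\mathbb{B}}(S_{\Gamma,\bar p,\gamma})=\mathrm{V}_{\mathbb{B}}(S'_{\Gamma,\bar p,\gamma})$; (F3) if $E$ induces a formula equivalence on $X\ne\emptyset$, then $E_{\Gamma,\bar p,\gamma}$ induces a formula equivalence on $\bar X$; (F4) if $E,E'$ induce the same formula equivalence on $X$, then so do $E_{\Gamma,\bar p,\gamma},E'_{\Gamma,\bar p,\gamma}$ on $\bar X$; (F5) if $\varphi$ induces a formula map $X/{\sim_X}\to Y/{\sim_Y}$, then $\varphi_{\Gamma,\bar p,\gamma}$ induces a formula map $\bar X/{\sim_{\bar X}}\to\bar Y/{\sim_{\bar Y}}$, where $\sim_{\bar X},\sim_{\bar Y}$ are induced by the translations of formulas inducing $\sim_X,\sim_Y$; (F6) if $\varphi,\varphi'$ induce the same formula map, then so do $\varphi_{\Gamma,\bar p,\gamma},\varphi'_{\Gamma,\bar p,\gamma}$; (F7) if $\varphi_{XY},\varphi_{YZ}$ induce formula maps $X/{\sim_X}\to Y/{\sim_Y}$, $Y/{\sim_Y}\to Z/{\sim_Z}$,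 then the composition of the formula maps induced by their translations is induced by the translation of $\exists\bar y(\varphi_{XY}(\bar x,\bar y)\wedge\varphi_{YZ}(\bar y,\bar z))$. If (F1)–(F7) hold for $(\alpha,\beta)$, one says that the translation $(\Gamma,\bar p,\gamma)$-functor $\mathcal{F}=\mathcal{F}_{\Gamma,\bar p,\gamma}\colon\mathcal{PLS}_{\alpha,\beta}(\mathbb{A})\to\mathcal{PLS}_{\alpha,\beta}(\mathbb{B})$ exists (is well-defined): $\mathcal{F}(\emptyset)=\emptyset$, $\mathcal{F}(X/{\sim_X})=\bar X/{\sim_{\bar X}}$, $\mathcal{F}(\emptyset\to O)=(\emptyset\to\mathcal{F}(O))$, and $\mathcal{F}$ sends the formula map induced by $\varphi$ to the one induced by $\varphi_{\Gamma,\bar p,\gamma}$. Functors of this form are translation functors (class $\mathbf{Tr}$); for $(\alpha,\beta)=(\infty,\infty)$ they are interpretation functors (class $\mathbf{Int}$); for $(\omega,\omega)$ they are functors $\mathcal{PDS}(\mathbb{A})\to\mathcal{PDS}(\mathbb{B})$. If the code $\Gamma$ is injective, the restriction $\mathcal{LS}_{\alpha,\beta}(\mathbb{A})\to\mathcal{LS}_{\alpha,\beta}(\mathbb{B})$ of the $(\Gamma,\bar p,\gamma)$-functor is an injective translation functor (class $\mathbf{Tr}_{\mathrm{inj}}$; for $(\omega,\omega)$, functors $\mathcal{DS}(\mathbb{A})\to\mathcal{DS}(\mathbb{B})$), and for $(\infty,\infty)$ an injective interpretation functor $\mathcal{LS}(\mathbb{A})\to\mathcal{LS}(\mathbb{B})$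 (class $\mathbf{Int}_{\mathrm{inj}}$). **Isomorphism relative to a class.** $\mathcal{C}\simeq_{\mathbf{K}}\mathcal{D}$ means that there are functors $\mathcal{F}\colon\mathcal{C}\to\mathcal{D}$ and $\mathcal{G}\colon\mathcal{D}\to\mathcal{C}$ in the class $\mathbf{K}$ with $\mathcal{G}\circ\mathcal{F}=\mathrm{id}_{\mathcal{C}}$ and $\mathcal{F}\circ\mathcal{G}=\mathrm{id}_{\mathcal{D}}$. **Composition.** For codes $\Gamma\colon L(\mathbb{A})\to L(\mathbb{B})$ and $\Delta\colon L(\mathbb{B})\to L(\mathbb{C})$, the code $\Gamma\circ\Delta\colon L(\mathbb{A})\to L(\mathbb{C})$ consists of the $\Delta$-translations $(U_\Gamma)_\Delta,(E_\Gamma)_\Delta,(c_\Gamma)_\Delta,(f_\Gamma)_\Delta,(R_\Gamma)_\Delta$; $\dim\Gamma\circ\Delta=\dim\Gamma\cdot\dim\Delta$, $\dim_{\mathrm{par}}\Gamma\circ\Delta=\dim_{\mathrm{par}}\Gamma\cdot\dim\Delta+\dim_{\mathrm{par}}\Delta$. The composition of interpretations $(\Gamma,\bar p,\mu_\Gamma)\colon\mathbb{A}\rightsquigarrow\mathbb{B}$ and $(\Delta,\bar q,\mu_\Delta)\colon\mathbb{B}\rightsquigarrow\mathbb{C}$ is the interpretation $(\Gamma\circ\Delta,(\bar{\bar p},\bar q),\mu_\Gamma\circ\mu_\Delta)\colon\mathbb{A}\rightsquigarrow\mathbb{C}$, where $\bar{\bar p}\in\mu_\Delta^{-1}(\bar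 p)$ (any choice). The identical interpretation of $\mathbb{A}$ in $\mathbb{A}$ is $(\mathbf{Id}_{L(\mathbb{A})},\emptyset,\mathrm{id}_A)$, where $\mathbf{Id}_{L(\mathbb{A})}$ has dimension 1, no parameters, $U$ is $x=x$, $E$ is $x=x'$, and symbols are coded by $x=c$, $f(x_1,\ldots,x_{n_f})=x_0$, $R(x_1,\ldots,x_{n_R})$. **Syntactic isomorphism.** Two interpretations $(\Gamma_1,\bar p_1,\mu_{\Gamma_1}),(\Gamma_2,\bar p_2,\mu_{\Gamma_2})\colon\mathbb{A}\rightsquigarrow\mathbb{B}$ are equal if $\Gamma_1(\mathbb{B},\bar p_1)=\Gamma_2(\mathbb{B},\bar p_2)$ and $\mu_{\Gamma_1}=\mu_{\Gamma_2}$. $\mathbb{A}$ and $\mathbb{B}$ are syntactically isomorphic if there are interpretations $(\Gamma,\bar p,\mu_\Gamma)\colon\mathbb{A}\rightsquigarrow\mathbb{B}$ and $(\Delta,\bar q,\mu_\Delta)\colon\mathbb{B}\rightsquigarrow\mathbb{A}$ such that $(\Gamma\circ\Delta,(\bar{\bar p},\bar q),\mu_\Gamma\circ\mu_\Delta)$ equals $(\mathbf{Id}_{L(\mathbb{A})},\emptyset,\mathrm{id}_A)$ and $(\Delta\circ\Gamma,(\bar{\bar q},\bar p),\mu_\Delta\circ\mu_\Gamma)$ equals $(\mathbf{Id}_{L(\mathbb{B})},\emptyset,\mathrm{id}_B)$. *)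

(* Defs.v *)
From mathcomp Require Import all_boot.
From mathcomp Require Import boolp classical_sets cardinality.

Set Implicit Arguments.
Unset Strict Implicit.
Unset Printing Implicit Defensive.

Local Open Scope classical_set_scope.

Definition tup (T : Type) (n : nat) : Type := 'I_n -> T.

Definition sumcase (X Y Z : Type) (f : X -> Z) (g : Y -> Z) (z : X + Y) : Z :=
  match z with inl x => f x | inr y => g y end.

Definition ocons (V T : Type) (a : T) (rho : V -> T) (o : option V) : T :=
  if o is Some v then rho v else a.

Lemma blk_subproof m d (i : 'I_m) (j : 'I_d) : i * d + j < m * d.
Proof.
apply: (@leq_trans (i.+1 * d)); first by rewrite mulSnr ltn_add2l.
by rewrite leq_mul2r ltn_ord orbT.
Qed.

(* position of the j-th coordinate of the i-th block in a concatenation of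
   m tuples of length d *)
Definition blk m d (i : 'I_m) (j : 'I_d) : 'I_(m * d) :=
  Ordinal (blk_subproof i j).

Record language := Language {
  csym : Type;
  fsym : Type;
  rsym : Type;
  far : fsym -> nat;
  rar : rsym -> nat }.

Record ops (L : language) (T : Type) := Ops {
  icst : csym L -> T;
  ifun : forall f : fsym L, tup T (far f) -> T;
  irel : forall r : rsym L, tup T (rar r) -> Prop }.

Record structure (L : language) := Structure {
  carrier :> Type;
  carrier_inhabited : inhabited carrier;
  sops :> ops L carrier }.

Definition isomorphism L (T T' : Type) (o : ops L T) (o' : ops L T') (h : T -> T') :=
  [/\ bijective h,
      forall c, h (icst o c) = icst o' c,
      forall f a, h (ifun o (f := f) a) = ifun o' (f := f) (h \o a) &
      forall r a, irel o (r := r) a <-> irel o' (r := r) (h \o a)].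

Definition expand (L : language) (P : Type) : language :=
  @Language (csym L + P) (fsym L) (rsym L) (@far L) (@rar L).

Definition expand_ops L (T : Type) (o : ops L T) : ops (expand L T) T :=
  @Ops (expand L T) T (sumcase (icst o) id) (@ifun L T o) (@irel L T o).

Definition full_exp L (A : structure L) : structure (expand L A) :=
  @Structure (expand L A) A (carrier_inhabited A) (expand_ops A).

Inductive term (L : language) (V : Type) : Type :=
| Tvar of V
| Tcst of csym L
| Tfun (f : fsym L) of ('I_(far f) -> term L V).

Arguments Tvar {L V} _.
Arguments Tcst {L V} _.
Arguments Tfun {L V} f _.

(* V is the type of the listed free variables; a quantifier binds [None] *)
Inductive formula (L : language) (V : Type) : Type :=
| Ftrue
| Feq of term L V & term L V
| Frel (r : rsym L) of ('I_(rar r) -> term L V)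
| Fnot of formula L V
| Fand of formula L V & formula L V
| For of formula L V & formula L V
| Fimp of formula L V & formula L V
| Fex of formula L (option V)
| Fall of formula L (option V).

Arguments Ftrue {L V}.
Arguments Frel {L V} r _.

Fixpoint eval L (T : Type) (o : ops L T) (V : Type) (rho : V -> T) (t : term L V) : T :=
  match t with
  | Tvar v => rho v
  | Tcst c => icst o c
  | Tfun f ts => ifun o (f := f) (fun i => eval o rho (ts i))
  end.

Fixpoint sat_ops L (T : Type) (o : ops L T) (V : Type) (phi : formula L V) (rho : V -> T) : Prop :=
  match phi with
  | Ftrue => True
  | Feq t u => eval o rho t = eval o rho u
  | Frel r ts => irel o (r := r) (fun i => eval o rho (ts i))
  | Fnot p => ~ sat_ops o p rho
  | Fand p q => sat_ops o p rho /\ sat_ops o q rho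
  | For p q => sat_ops o p rho \/ sat_ops o q rho
  | Fimp p q => sat_ops o p rho -> sat_ops o q rho
  | Fex p => exists a, sat_ops o p (ocons a rho)
  | Fall p => forall a, sat_ops o p (ocons a rho)
  end.

Definition sat L (M : structure L) (V : Type) (phi : formula L V) (rho : V -> M) : Prop :=
  sat_ops M phi rho.

Definition logically_equiv L (V : Type) (phi psi : formula L V) : Prop :=
  forall (M : structure L) (rho : V -> M), sat phi rho <-> sat psi rho.

Fixpoint rename_term L (V W : Type) (h : V -> W) (t : term L V) : term L W :=
  match t with
  | Tvar v => Tvar (h v)
  | Tcst c => Tcst c
  | Tfun f ts => Tfun f (fun i => rename_term h (ts i))
  end.

Fixpoint rename L (V W : Type) (h : V -> W) (phi : formula L V) : formula L W :=
  match phi with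
  | Ftrue => Ftrue
  | Feq t u => Feq (rename_term h t) (rename_term h u)
  | Frel r ts => Frel r (fun i => rename_term h (ts i))
  | Fnot p => Fnot (rename h p)
  | Fand p q => Fand (rename h p) (rename h q)
  | For p q => For (rename h p) (rename h q)
  | Fimp p q => Fimp (rename h p) (rename h q)
  | Fex p => Fex (rename (omap h) p)
  | Fall p => Fall (rename (omap h) p)
  end.

(* [inst s phi] replaces each free variable v by the variable or by the new
   constant [s v] *)
Fixpoint inst_term L (P V W : Type) (s : V -> W + P) (t : term L V) :
    term (expand L P) W :=
  match t with
  | Tvar v =>
      match s v with
      | inl w => Tvar w
      | inr a => @Tcst (expand L P) W (inr a)
      end
  | Tcst c => @Tcst (expand L P) W (inl c)
  | Tfun f ts => @Tfun (expand L P) W f (fun i => inst_term s (ts i))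
  end.

Definition inst_up (P V W : Type) (s : V -> W + P) (o : option V) : option W + P :=
  if o is Some v then
    match s v with inl w => inl (Some w) | inr a => inr a end
  else inl None.

Fixpoint inst L (P V W : Type) (s : V -> W + P) (phi : formula L V) :
    formula (expand L P) W :=
  match phi with
  | Ftrue => Ftrue
  | Feq t u => Feq (inst_term s t) (inst_term s u)
  | Frel r ts => @Frel (expand L P) W r (fun i => inst_term s (ts i))
  | Fnot p => Fnot (inst s p)
  | Fand p q => Fand (inst s p) (inst s q)
  | For p q => For (inst s p) (inst s q)
  | Fimp p q => Fimp (inst s p) (inst s q)
  | Fex p => Fex (inst (inst_up s) p)
  | Fall p => Fall (inst (inst_up s) p)
  end.

Definition fands L (V : Type) (s : seq (formula L V)) : formula L V :=
  if s is p :: s' then foldl (@Fand L V) p s' else Ftrue.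

Definition block_var (V : Type) n (z : V + 'I_n.+1) : option (V + 'I_n) :=
  match z with
  | inl v => Some (inl v)
  | inr i => if unlift ord0 i is Some j then Some (inr j) else None
  end.

Fixpoint qblock L (Q : forall W : Type, formula L (option W) -> formula L W)
    (V : Type) (n : nat) : formula L (V + 'I_n) -> formula L V :=
  match n with
  | 0 => rename (sumcase id (fun i : 'I_0 =>
                   False_rect V (notF (ltn_ord i))))
  | n'.+1 => fun phi => qblock Q (Q _ (rename (@block_var V n') phi))
  end.

Definition fexs L (V : Type) n : formula L (V + 'I_n) -> formula L V :=
  @qblock L (@Fex L) V n.
Definition falls L (V : Type) n : formula L (V + 'I_n) -> formula L V :=
  @qblock L (@Fall L) V n.

(* unnested atomic formulas; in [Ufun f x] the variable [x ord0] is the value *)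
Inductive uatom (L : language) (V : Type) : Type :=
| Ueq of V & V
| Ucst of V & csym L
| Ufun (f : fsym L) of ('I_(far f).+1 -> V)
| Urel (r : rsym L) of ('I_(rar r) -> V).

Definition uatom_form L (V : Type) (a : uatom L V) : formula L V :=
  match a with
  | Ueq x y => Feq (Tvar x) (Tvar y)
  | Ucst x c => Feq (Tvar x) (Tcst c)
  | Ufun f x => Feq (Tfun f (fun i => Tvar (x (lift ord0 i)))) (Tvar (x ord0))
  | Urel r x => Frel r (fun i => Tvar (x i))
  end.

(* a non-empty list is a head and a tail; the boolean of a literal is its sign *)
Definition nelist (T : Type) : Type := (T * seq T)%type.
Definition literal L (V : Type) : Type := (bool * uatom L V)%type.
Definition matrix L (V : Type) : Type := nelist (nelist (literal L V)).

Inductive nform (L : language) (V : Type) : Type :=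
| Nmat of matrix L V
| Nex of nform L (option V)
| Nall of nform L (option V).

Definition nefold (T F : Type) (op : F -> F -> F) (h : T -> F) (s : nelist T) : F :=
  foldl op (h s.1) (map h s.2).

(* the disjunction of conjunctions of literals, atoms being read by [at] *)
Definition matrix_form L (V : Type) L' (W : Type) (at_ : uatom L V -> formula L' W)
    (m : matrix L V) : formula L' W :=
  nefold (@For L' W)
    (nefold (@Fand L' W)
      (fun l : literal L V => if l.1 then at_ l.2 else Fnot (at_ l.2))) m.

Fixpoint nform_form L (V : Type) (n : nform L V) : formula L V :=
  match n with
  | Nmat m => matrix_form (@uatom_form L V) m
  | Nex n' => Fex (nform_form n')
  | Nall n' => Fall (nform_form n')
  end.

Definition normal L (V : Type) (phi : formula L V) : Prop :=
  exists n, phi = nform_form n.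

(* n is an admissible normal form of phi: phi itself if phi is normal *)
Definition normal_form_of L (V : Type) (phi : formula L V) (n : nform L V) : Prop :=
  phi = nform_form n \/ (~ normal phi /\ logically_equiv phi (nform_form n)).

Definition cvar (d k n : nat) : Type := ('I_n * 'I_d + 'I_k)%type.

(* d is the dimension and k the number of parameters *)
Record code (LA LB : language) (d k : nat) := Code {
  cU : formula LB (cvar d k 1);
  cE : formula LB (cvar d k 2);
  cC : csym LA -> formula LB (cvar d k 1);
  cF : forall f : fsym LA, formula LB (cvar d k (far f).+1);
  cR : forall r : rsym LA, formula LB (cvar d k (rar r)) }.

Definition injective_code LA LB d k (G : code LA LB d k) : Prop :=
  cE G = fands [seq Feq (Tvar (inl (ord0, j))) (Tvar (inl (ord_max, j)))
               | j <- enum 'I_d].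

Definition id_code (L : language) : code L L 1 0 :=
  let x n (i : 'I_n) : term L (cvar 1 0 n) := Tvar (inl (i, ord0)) in
  @Code L L 1 0
    (Feq (x 1 ord0) (x 1 ord0))
    (Feq (x 2 ord0) (x 2 ord_max))
    (fun c => Feq (x 1 ord0) (Tcst c))
    (fun f => Feq (Tfun f (fun i => x (far f).+1 (lift ord0 i)))
                  (x (far f).+1 ord0))
    (fun r => Frel r (fun i => x (rar r) i)).

(* substitution of blocks: the i-th tuple becomes the tuple of the variable x i *)
Definition at_vars d k n (V : Type) (x : 'I_n -> V) (z : cvar d k n) :
    (V * 'I_d + 'I_k)%type :=
  match z with inl ij => inl (x ij.1, ij.2) | inr l => inr l end.

Definition uatom_tr LA LB d k (G : code LA LB d k) (V : Type) (a : uatom LA V) :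
    formula LB (V * 'I_d + 'I_k) :=
  match a with
  | Ueq x y => rename (at_vars (fun i : 'I_2 => if i == ord0 then x else y)) (cE G)
  | Ucst x c => rename (at_vars (fun=> x)) (cC G c)
  | Ufun f x => rename (at_vars x) (cF G f)
  | Urel r x => rename (at_vars x) (cR G r)
  end.

(* U of the block of variables just bound, resp. the renaming which moves the
   block of the variable [None] to the quantified block *)
Definition bound_U LA LB d k (G : code LA LB d k) (V : Type) :
    formula LB ((V * 'I_d + 'I_k) + 'I_d) :=
  rename (fun z : cvar d k 1 =>
    match z with inl ij => inr ij.2 | inr l => inl (inr l) end) (cU G).

Definition bind_block d k (V : Type) (z : (option V * 'I_d + 'I_k)%type) :
    ((V * 'I_d + 'I_k) + 'I_d)%type :=
  match z with
  | inl (Some v, j) => inl (inl (v, j))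
  | inl (None, j) => inr j
  | inr l => inl (inr l)
  end.

Fixpoint nform_tr LA LB d k (G : code LA LB d k) (V : Type) (n : nform LA V) :
    formula LB (V * 'I_d + 'I_k) :=
  match n with
  | Nmat m => matrix_form (uatom_tr G (V := _)) m
  | Nex n' => fexs (Fand (bound_U G _) (rename (@bind_block d k _) (nform_tr G n')))
  | Nall n' => falls (Fimp (bound_U G _) (rename (@bind_block d k _) (nform_tr G n')))
  end.

Definition tr LA LB d k (G : code LA LB d k) (V : finType) (n : nform LA V) :
    formula LB (V * 'I_d + 'I_k) :=
  Fand (fands [seq rename (at_vars (fun=> v)) (cU G) | v <- enum V])
       (nform_tr G n).

Definition is_translation LA LB d k (G : code LA LB d k) (V : finType)
    (phi : formula LA V) (chi : formula LB (V * 'I_d + 'I_k)) : Prop :=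
  exists2 n, normal_form_of phi n & chi = tr G n.

Definition aform L (A : structure L) (V : Type) : Type := formula (expand L A) V.

Definition asat L (A : structure L) (V : Type) (phi : aform A V) (rho : V -> A) : Prop :=
  @sat _ (full_exp A) V phi rho.

Definition asat2 L (A : structure L) m s (phi : aform A ('I_m + 'I_s))
    (a : tup A m) (b : tup A s) : Prop :=
  asat phi (sumcase a b).

(* chi is a translation, along the extended code (G, p, g), of a formula psi in
   the free variables V; its free variables V * 'I_d are renamed by h.
   psi is phi(x, a) with phi in L(A) and a listing distinct parameters. *)
Definition is_ext_translation LA LB (A : structure LA) (B : structure LB) d k
    (G : code LA LB d k) (p : tup B k) (g : A -> tup B d)
    (V : finType) (W : Type) (h : V * 'I_d -> W)
    (psi : aform A V) (chi : aform B W) : Prop :=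
  exists (s : nat) (a : tup A s) (phi : formula LA (V + 'I_s))
         (phi' : formula LB ((V + 'I_s) * 'I_d + 'I_k)),
  [/\ injective a,
      psi = inst (sumcase inl (fun i => inr (a i))) phi,
      is_translation G phi phi' &
      chi = inst (fun z => match z with
                           | inl (inl v, j) => inl (h (v, j))
                           | inl (inr i, j) => inr (g (a i) j)
                           | inr l => inr (p l)
                           end) phi'].

Definition blk1 m d (z : 'I_m * 'I_d) : 'I_(m * d) := blk z.1 z.2.

Definition blk2 m s d (z : ('I_m + 'I_s) * 'I_d) : 'I_(m * d) + 'I_(s * d) :=
  match z.1 with inl i => inl (blk i z.2) | inr i => inr (blk i z.2) end.

Definition quot (T : Type) (X : set T) (R : T -> T -> Prop) : Type :=
  {C : set T | exists2 a, X a & C = [set b | R a b]}.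

Definition cls (T : Type) (X : set T) (R : T -> T -> Prop) (a : T) (Xa : X a) : quot X R :=
  exist _ [set b | R a b] (ex_intro2 _ _ a Xa erefl).

Definition equivalence_on (T : Type) (X : set T) (R : T -> T -> Prop) : Prop :=
  [/\ forall a, X a -> R a a,
      forall a b, X a -> X b -> R a b -> R b a &
      forall a b c, X a -> X b -> X c -> R a b -> R b c -> R a c].

(* what the formulas of a code define in a structure with underlying set T:
   a subset of T^d with a relation on it, and preimages of the operations and
   relations of the quotient.  All components live on qU, so that equality of
   these data is equality of the quotient structures. *)
Record qstruct (L : language) (T : Type) := QStruct {
  qdim : nat;
  qU : set (tup T qdim);
  qE : tup T qdim -> tup T qdim -> Prop;
  qC : csym L -> set (tup T qdim);
  qF : forall f : fsym L, set (tup (tup T qdim) (far f).+1);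
  qR : forall r : rsym L, set (tup (tup T qdim) (rar r)) }.

Arguments qU {L T} q.
Arguments qE {L T} q.
Arguments qC {L T} q.
Arguments qF {L T} q f.
Arguments qR {L T} q r.

Section CodeSemantics.
Variables (LA LB : language) (B : structure LB) (d k : nat).
Variables (G : code LA LB d k) (p : tup B k).

Definition csat n (phi : formula LB (cvar d k n)) (b : tup (tup B d) n) : Prop :=
  sat phi (sumcase (fun ij => b ij.1 ij.2) p).

Definition code_U : set (tup B d) := [set b | csat (cU G) (fun=> b)].

Definition on_U n (phi : formula LB (cvar d k n)) : set (tup (tup B d) n) :=
  [set b | (forall i, code_U (b i)) /\ csat phi b].

Definition realize : qstruct LA B :=
  @QStruct LA B d code_U
    (fun b b' => on_U (cE G) (fun i : 'I_2 => if i == ord0 then b else b'))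
    (fun c => [set b | on_U (cC G c) (fun=> b)])
    (fun f => on_U (cF G f))
    (fun r => on_U (cR G r)).
End CodeSemantics.

Definition presents L (T : Type) (q : qstruct L T) (o : ops L (quot (qU q) (qE q))) : Prop :=
  let cl b (Ub : qU q b) := cls (qE q) Ub in
  [/\ forall c b (Ub : qU q b), qC q c b <-> cl b Ub = icst o c,
      forall f b (Ub : forall i, qU q (b i)),
        qF q f b <->
        cl _ (Ub ord0) = ifun o (f := f) (fun i => cl _ (Ub (lift ord0 i))) &
      forall r b (Ub : forall i, qU q (b i)),
        qR q r b <-> irel o (r := r) (fun i => cl _ (Ub i))].

Definition well_defined_with L (T : Type) (q : qstruct L T)
    (o : ops L (quot (qU q) (qE q))) : Prop :=
  [/\ qU q !=set0, equivalence_on (qU q) (qE q) & presents o].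

(* the data of an interpretation of A in B; only the values of imu on the
   subset defined by U are meaningful *)
Record idata LA LB (A : structure LA) (B : structure LB) := IData {
  idim : nat;
  ipdim : nat;
  icode : code LA LB idim ipdim;
  ipar : tup B ipdim;
  imu : tup B idim -> A }.

Arguments ipar {LA LB A B} _.
Arguments imu {LA LB A B} _.

Definition irealize LA LB (A : structure LA) (B : structure LB) (I : idata A B) :
    qstruct LA B := realize (icode I) (ipar I).

Definition iU LA LB (A : structure LA) (B : structure LB) (I : idata A B) :
    set (tup B (idim I)) := code_U (icode I) (ipar I).

Arguments iU {LA LB A B} I.

Definition is_interpretation LA LB (A : structure LA) (B : structure LB)
    (I : idata A B) : Prop :=
  exists o : ops LA (quot (qU (irealize I)) (qE (irealize I))),
  [/\ well_defined_with o,
      forall a : A, exists2 b, iU I b & imu I b = a &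
      exists2 mubar, isomorphism o A mubar &
        forall b (Ub : qU (irealize I) b),
          mubar (cls (qE (irealize I)) Ub) = imu I b].

Definition interp_eq LA LB (A : structure LA) (B : structure LB)
    (I J : idata A B) : Prop :=
  irealize I = irealize J /\
  forall b b', iU I b ->
    existT (tup B) (idim I) b = existT (tup B) (idim J) b' -> imu I b = imu J b'.

Definition id_idata L (A : structure L) : idata A A :=
  @IData L L A A 1 0 (id_code L)
    (fun i => False_rect A (notF (ltn_ord i))) (fun b => b ord0).

Definition comp_var d k d' k' n (z : cvar d k n * 'I_d' + 'I_k') :
    cvar (d * d') (k * d' + k') n :=
  match z with
  | inl (inl (i, j), l) => inl (i, blk j l)
  | inl (inr y, l) => inr (lshift k' (blk y l))
  | inr y => inr (rshift (k * d') y)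
  end.

(* H is a composition of G and D (it depends on choices of normal forms) *)
Definition is_comp_code LA LB LC d k d' k' (G : code LA LB d k)
    (D : code LB LC d' k') (H : code LA LC (d * d') (k * d' + k')) : Prop :=
  let trD n (phi : formula LB (cvar d k n))
          (chi : formula LC (cvar (d * d') (k * d' + k') n)) :=
    exists2 chi0, @is_translation LB LC d' k' D
                    (('I_n * 'I_d + 'I_k)%type : finType) phi chi0 &
                  chi = rename (@comp_var d k d' k' n) chi0 in
  [/\ trD 1 (cU G) (cU H),
      trD 2 (cE G) (cE H),
      forall c, trD 1 (cC G c) (cC H c),
      forall f, trD (far f).+1 (cF G f) (cF H f) &
      forall r, trD (rar r) (cR G r) (cR H r)].

(* K is a composition of I and J: its parameters are a preimage of the
   parameters of I under the coordinate map of J, followed by those of J *)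
Definition is_comp LA LB LC (A : structure LA) (B : structure LB)
    (C : structure LC) (I : idata A B) (J : idata B C) (K : idata A C) : Prop :=
  exists (H : code LA LC (idim I * idim J) (ipdim I * idim J + ipdim J))
         (r : tup C (ipdim I * idim J + ipdim J)),
  [/\ is_comp_code (icode I) (icode J) H,
      forall i, let pi := fun j => r (lshift (ipdim J) (blk i j)) in
        iU J pi /\ imu J pi = ipar I i,
      forall i, r (rshift (ipdim I * idim J) i) = ipar J i &
      K = @IData LA LC A C _ _ H r
            (fun c => imu I (fun i => imu J (fun j => c (blk i j))))].

Definition syntactically_isomorphic LA LB (A : structure LA) (B : structure LB) :
    Prop :=
  exists (I : idata A B) (J : idata B A),
  [/\ is_interpretation I, is_interpretation J,
      exists2 K, is_comp I J K & interp_eq K (id_idata A) &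
      exists2 K, is_comp J I K & interp_eq K (id_idata B)].

Record category := Category {
  obj : Type;
  hom : obj -> obj -> Type;
  idc : forall x, hom x x;
  compc : forall x y z, hom y z -> hom x y -> hom x z;
  comp1c : forall x y (f : hom x y), compc (idc y) f = f;
  compc1 : forall x y (f : hom x y), compc f (idc x) = f;
  compcA : forall x y z t (h : hom z t) (g : hom y z) (f : hom x y),
    compc h (compc g f) = compc (compc h g) f }.

Record functor (C D : category) := Functor {
  fobj :> obj C -> obj D;
  fhom : forall x y : obj C, hom x y -> hom (fobj x) (fobj y);
  fhom1 : forall x, fhom (idc x) = idc (fobj x);
  fhomM : forall x y z (g : hom y z) (f : hom x y),
    fhom (compc g f) = compc (fhom g) (fhom f) }.

Definition arrow (C : category) (x y : obj C) (f : hom x y) :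
    {xy : obj C * obj C & hom xy.1 xy.2} :=
  existT (fun xy : obj C * obj C => hom xy.1 xy.2) (x, y) f.

Definition functor_eq C D (F G : functor C D) : Prop :=
  (forall x, F x = G x) /\
  (forall x y (f : hom x y), arrow (fhom F f) = arrow (fhom G f)).

Definition fid (C : category) : functor C C :=
  @Functor C C id (fun _ _ f => f) (fun _ => erefl) (fun _ _ _ _ _ => erefl).

Definition fcomp C D E (G : functor D E) (F : functor C D) : functor C E.
Proof.
refine (@Functor C E (fun x => G (F x)) (fun x y f => fhom G (fhom F f)) _ _).
- by move=> x; rewrite !fhom1.
- by move=> x y z g f; rewrite !fhomM.
Defined.

Definition iso_relative C D (K : functor C D -> Prop) (K' : functor D C -> Prop) :
    Prop :=
  exists (F : functor C D) (G : functor D C),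
  [/\ K F, K' G, functor_eq (fcomp G F) (fid C) & functor_eq (fcomp F G) (fid D)].

Definition full_sub (C : category) (P : obj C -> Prop) : category :=
  @Category {x : obj C | P x} (fun x y => hom (sval x) (sval y))
    (fun x => idc (sval x)) (fun x y z g f => compc g f)
    (fun x y f => comp1c f) (fun x y f => compc1 f)
    (fun x y z t h g f => compcA h g f).

Definition full_incl (C : category) (P : obj C -> Prop) : functor (full_sub P) C :=
  @Functor (full_sub P) C sval (fun _ _ f => f)
    (fun _ => erefl) (fun _ _ _ _ _ => erefl).

(* the pairs (omega, omega) and (infinity, infinity); a finite system involves
   finitely many parameters *)
Inductive size_class := Finite_systems | All_systems.

Definition size_ok (k : size_class) (T : Type) (S : set T) : Prop :=
  if k is Finite_systems then finite_set S else True.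

Section Geometry.
Variables (L : language) (A : structure L).

Definition Vset m (S : set (aform A 'I_m)) : set (tup A m) :=
  [set a | forall psi, S psi -> asat psi a].

Definition logical (k : size_class) m (X : set (tup A m)) : Prop :=
  exists2 S, size_ok k S & X = Vset S.

Definition erel m (E : aform A ('I_m + 'I_m)) (X : set (tup A m))
    (a a' : tup A m) : Prop :=
  [/\ X a, X a' & asat2 E a a'].

Definition induces_equiv m (E : aform A ('I_m + 'I_m)) (X : set (tup A m)) : Prop :=
  equivalence_on X (erel E X) /\
  (forall a a', X a -> asat2 E a a' \/ asat2 E a' a -> X a').

Definition induces_map m s (phi : aform A ('I_m + 'I_s))
    (X : set (tup A m)) (RX : tup A m -> tup A m -> Prop)
    (Y : set (tup A s)) (RY : tup A s -> tup A s -> Prop)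
    (f : quot X RX -> quot Y RY) : Prop :=
  (forall a b (Xa : X a) (Yb : Y b),
     f (cls RX Xa) = cls RY Yb <-> asat2 phi a b) /\
  (forall a b, X a -> ~ Y b -> ~ asat2 phi a b).

(* exists y, phi(x, y) /\ psi(y, z) *)
Definition comp_form m s r (phi : aform A ('I_m + 'I_s))
    (psi : aform A ('I_s + 'I_r)) : aform A ('I_m + 'I_r) :=
  fexs (Fand (rename (sumcase (fun i => inl (inl i)) inr) phi)
             (rename (sumcase inr (fun i => inl (inr i))) psi)).

(* a non-empty projective logical set oX / oR in dimension m *)
Record plset (k : size_class) (m : nat) := PLSet {
  oX : set (tup A m);
  oR : tup A m -> tup A m -> Prop;
  oX_nonempty : oX !=set0;
  oX_logical : logical k oX;
  oR_formula : exists2 E, induces_equiv E oX & oR = erel E oX }.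

Definition oquot k m (x : plset k m) : Type := quot (oX x) (@oR k m x).

Definition fmap k m s (x : plset k m) (y : plset k s) : Type :=
  {f : oquot x -> oquot y | exists phi, induces_map phi f}.

(* [None] is the empty set *)
Definition plobj (k : size_class) : Type := option {m : nat & plset k m}.

Definition plob k m (x : plset k m) : plobj k := Some (existT _ m x).

Definition plhom k (x y : plobj k) : Type :=
  match x, y with
  | None, _ => unit
  | Some _, None => Empty_set
  | Some x', Some y' => fmap (projT2 x') (projT2 y')
  end.

Lemma eval_rename L' (T : Type) (o : ops L' T) (V W : Type) (h : V -> W)
    (t : term L' V) (rho : W -> T) :
  eval o rho (rename_term h t) = eval o (rho \o h) t.
Proof.
elim: t => //= f ts IH; congr (ifun _ _); apply: funext => i; exact: IH.
Qed.

Lemma sat_rename L' (T : Type) (o : ops L' T) (V : Type) (phi : formula L' V) :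
  forall (W : Type) (h : V -> W) (rho : W -> T),
  sat_ops o (rename h phi) rho <-> sat_ops o phi (rho \o h).
Proof.
have oc (U W : Type) (h : U -> W) (rho : W -> T) a :
    ocons a rho \o omap h = ocons a (rho \o h).
  by apply: funext => -[].
elim: phi => //=.
- by move=> U t u W h rho; rewrite !eval_rename.
- move=> U r ts W h rho; rewrite (_ : (fun i => _) = (fun i => eval o (rho \o h) (ts i))) //.
  by apply: funext => i; rewrite eval_rename.
- by move=> U p IH W h rho; rewrite IH.
- by move=> U p IHp q IHq W h rho; rewrite IHp IHq.
- by move=> U p IHp q IHq W h rho; rewrite IHp IHq.
- by move=> U p IHp q IHq W h rho; rewrite IHp IHq.
- move=> U p IH W h rho; split=> -[a]; rewrite ?IH ?oc => H; exists a => //.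
  by rewrite IH oc.
- by move=> U p IH W h rho; split=> H a; move: (H a); rewrite IH oc.
Qed.

Lemma sat_fexs L' (T : Type) (o : ops L' T) (V : Type) n
    (phi : formula L' (V + 'I_n)) (rho : V -> T) :
  sat_ops o (fexs phi) rho <-> exists b : tup T n, sat_ops o phi (sumcase rho b).
Proof.
rewrite /fexs; elim: n V phi rho => [|n IH] V phi rho /=.
  rewrite sat_rename; split=> [H|[b H]].
    exists (fun i : 'I_0 => False_rect T (notF (ltn_ord i))).
    by congr (sat_ops o phi _): H; apply: funext => -[//|[]].
  by congr (sat_ops o phi _): H; apply: funext => -[//|[]].
rewrite IH /=; split.
  move=> [b [a]]; rewrite sat_rename => H.
  exists (fun i => if unlift ord0 i is Some j then b j else a).
  congr (sat_ops o phi _): H; apply: funext => -[v|i] //=.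
  by case: (unlift ord0 i).
move=> [b H]; exists (b \o lift ord0), (b ord0); rewrite sat_rename.
congr (sat_ops o phi _): H; apply: funext => -[v|i] //=.
by case: unliftP => [j|] ->.
Qed.

Lemma asat2_comp m s r (phi : aform A ('I_m + 'I_s)) (psi : aform A ('I_s + 'I_r))
    (a : tup A m) (c : tup A r) :
  asat2 (comp_form phi psi) a c <->
  exists2 b : tup A s, asat2 phi a b & asat2 psi b c.
Proof.
rewrite /asat2 /asat /sat sat_fexs /=.
have e1 b : sumcase (sumcase a c) b \o sumcase (fun i => inl (inl i)) inr
            = sumcase a b by apply: funext => -[].
have e2 b : sumcase (sumcase a c) b \o sumcase inr (fun i => inl (inr i))
            = sumcase b c by apply: funext => -[].
split=> [[b [/sat_rename H /sat_rename K]]|[b H K]]; exists b.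
- by rewrite -e1.
- by rewrite -e2.
- by split; apply/sat_rename; rewrite ?e1 ?e2.
Qed.

Lemma quotP (T : Type) (X : set T) (R : T -> T -> Prop) (q : quot X R) :
  exists a (Xa : X a), q = cls R Xa.
Proof. by case: q => C [a Xa e]; exists a, Xa; subst C. Qed.

Lemma cls_eq m (E : aform A ('I_m + 'I_m)) (X : set (tup A m)) a b
    (Xa : X a) (Xb : X b) : induces_equiv E X ->
  cls (erel E X) Xa = cls (erel E X) Xb <-> asat2 E a b.
Proof.
move=> [[rE sE tE] _]; split=> [[/(congr1 (fun C => C b)) e]|Eab].
  have : [set c | erel E X b c] b by exact: rE.
  by rewrite -e => -[].
apply: eq_exist => //=; apply/seteqP; split=> c /=.
  by move=> Eac; have [_ Xc _] := Eac; apply: (tE _ a) => //; apply: sE.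
by move=> Ebc; have [_ Xc _] := Ebc; apply: (tE _ b).
Qed.

Lemma induces_id k m (x : plset k m) :
  exists phi, @induces_map m m phi (oX x) (@oR k m x) (oX x) (@oR k m x) id.
Proof.
case: x => X R /= _ _ [E hE ->]; exists E; split; first by move=> *; exact: cls_eq.
by move=> a b Xa nXb H; apply: nXb; apply: (hE.2 a b Xa); left.
Qed.

Lemma induces_comp k m s r (x : plset k m) (y : plset k s) (z : plset k r)
    (f : oquot x -> oquot y) (g : oquot y -> oquot z) phi psi :
  induces_map phi f -> induces_map psi g ->
  induces_map (comp_form phi psi) (g \o f).
Proof.
move=> [f1 f2] [g1 g2]; split=> [a c Xa Zc|a c Xa nZc].
  rewrite asat2_comp /=; split.
    have [b [Yb e]] := quotP (f (cls _ Xa)); rewrite e => h.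
    by exists b; [exact/f1 | exact/g1].
  move=> [b H K]; have Yb : oX y b by apply: contrapT => /(f2 _ _ Xa).
  by rewrite (f1 _ _ Xa Yb).2 //; apply/g1.
rewrite asat2_comp => -[b H K].
have Yb : oX y b by apply: contrapT => /(f2 _ _ Xa).
exact: (g2 _ _ Yb nZc).
Qed.

Definition fmap_id k m (x : plset k m) : fmap x x :=
  exist _ id (induces_id x).

Lemma fmap_comp_subproof k m s r (x : plset k m) (y : plset k s)
    (z : plset k r) (g : fmap y z) (f : fmap x y) :
  exists phi, induces_map phi (sval g \o sval f).
Proof.
case: f g => f [phi hf] [g [psi hg]]; exists (comp_form phi psi).
exact: induces_comp.
Qed.

Definition fmap_comp k m s r (x : plset k m) (y : plset k s) (z : plset k r)
    (g : fmap y z) (f : fmap x y) : fmap x z :=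
  exist _ (sval g \o sval f) (fmap_comp_subproof g f).

Definition plid k (x : plobj k) : plhom x x :=
  match x with None => tt | Some x' => fmap_id (projT2 x') end.

Definition plcomp k (x y z : plobj k) : plhom y z -> plhom x y -> plhom x z :=
  match x, y, z return plhom y z -> plhom x y -> plhom x z with
  | None, _, _ => fun _ _ => tt
  | Some _, None, _ => fun _ f => match f with end
  | Some _, Some _, None => fun g _ => match g with end
  | Some _, Some _, Some _ => fun g f => fmap_comp g f
  end.

Definition PLS (k : size_class) : category.
Proof.
refine (@Category (plobj k) (@plhom k) (@plid k) (@plcomp k) _ _ _).
- by move=> [x|] [y|] //=; [move=> [f ?]; apply: eq_exist | move=> [] | move=> []].
- by move=> [x|] [y|] //=; [move=> [f ?]; apply: eq_exist | move=> [] | move=> []].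
- by move=> [x|] [y|] [z|] [t|] //= h g f; try apply: eq_exist; case: f; case: g; case: h.
Defined.

(* the objects X/= *)
Definition is_logical_object k (o : obj (PLS k)) : Prop :=
  match o with
  | None => True
  | Some x => forall a b, oX (projT2 x) a -> oX (projT2 x) b ->
                oR (projT2 x) a b <-> a = b
  end.

Definition LS (k : size_class) : category :=
  full_sub (@is_logical_object k).

Definition LS_incl (k : size_class) : functor (LS k) (PLS k) :=
  full_incl (@is_logical_object k).
End Geometry.

Section Translation.
Variables (LA LB : language) (A : structure LA) (B : structure LB).
Variables (sc : size_class) (d k : nat).
Variables (G : code LA LB d k) (p : tup B k) (g : A -> tup B d).

Definition tr1 m (psi : aform A 'I_m) (chi : aform B 'I_(m * d)) : Prop :=
  is_ext_translation G p g (@blk1 m d) psi chi.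

Definition tr2 m s (psi : aform A ('I_m + 'I_s))
    (chi : aform B ('I_(m * d) + 'I_(s * d))) : Prop :=
  is_ext_translation G p g (@blk2 m s d) psi chi.

(* T consists of one translation of each formula of S *)
Definition trset m (S : set (aform A 'I_m)) (T : set (aform B 'I_(m * d))) : Prop :=
  exists2 tau, (forall psi, S psi -> tr1 psi (tau psi)) & T = tau @` S.

Definition system m (S : set (aform A 'I_m)) : Prop :=
  S !=set0 /\ size_ok sc S.

(* S and E present a non-empty projective logical set, and T and E' are
   translations of S and E *)
Definition tr_presentation m (S : set (aform A 'I_m)) (E : aform A ('I_m + 'I_m))
    (T : set (aform B 'I_(m * d))) (E' : aform B ('I_(m * d) + 'I_(m * d))) : Prop :=
  [/\ system S, Vset S !=set0, induces_equiv E (Vset S), trset S T & tr2 E E'].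

Definition pres_quot L (C : structure L) m (S : set (aform C 'I_m))
    (E : aform C ('I_m + 'I_m)) : Type :=
  quot (Vset S) (erel E (Vset S)).

Definition same_equiv L (C : structure L) m (E1 E2 : aform C ('I_m + 'I_m))
    (X : set (tup C m)) : Prop :=
  [/\ induces_equiv E1 X, induces_equiv E2 X & erel E1 X = erel E2 X].

Definition F1 : Prop := forall m (S : set (aform A 'I_m)) T,
  system S -> trset S T -> (Vset S = set0 <-> Vset T = set0).

Definition F2 : Prop := forall m (S S' : set (aform A 'I_m)) T T',
  system S -> system S' -> trset S T -> trset S' T' ->
  Vset S = Vset S' -> Vset T = Vset T'.

Definition F3 : Prop := forall m (S : set (aform A 'I_m)) E T E',
  tr_presentation S E T E' -> induces_equiv E' (Vset T).

Definition F4 : Prop := forall m (S : set (aform A 'I_m)) T E1 E2 E1' E2',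
  system S -> Vset S !=set0 -> trset S T -> tr2 E1 E1' -> tr2 E2 E2' ->
  same_equiv E1 E2 (Vset S) -> same_equiv E1' E2' (Vset T).

Definition F5 : Prop :=
  forall m (S : set (aform A 'I_m)) E T E' s (S1 : set (aform A 'I_s)) E1 T1 E1'
    phi phi' (f : pres_quot S E -> pres_quot S1 E1),
  tr_presentation S E T E' -> tr_presentation S1 E1 T1 E1' ->
  tr2 phi phi' -> induces_map phi f ->
  exists f' : pres_quot T E' -> pres_quot T1 E1', induces_map phi' f'.

Definition F6 : Prop :=
  forall m (S : set (aform A 'I_m)) E T E' s (S1 : set (aform A 'I_s)) E1 T1 E1'
    phi phi' psi psi' (f : pres_quot S E -> pres_quot S1 E1),
  tr_presentation S E T E' -> tr_presentation S1 E1 T1 E1' ->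
  tr2 phi phi' -> tr2 psi psi' -> induces_map phi f -> induces_map psi f ->
  exists2 f' : pres_quot T E' -> pres_quot T1 E1',
    induces_map phi' f' & induces_map psi' f'.

Definition F7 : Prop :=
  forall m (S : set (aform A 'I_m)) E T E' s (S1 : set (aform A 'I_s)) E1 T1 E1'
    r (S2 : set (aform A 'I_r)) E2 T2 E2' phi phi' psi psi' chi
    (f : pres_quot S E -> pres_quot S1 E1) (h : pres_quot S1 E1 -> pres_quot S2 E2)
    (f' : pres_quot T E' -> pres_quot T1 E1') (h' : pres_quot T1 E1' -> pres_quot T2 E2'),
  tr_presentation S E T E' -> tr_presentation S1 E1 T1 E1' ->
  tr_presentation S2 E2 T2 E2' ->
  tr2 phi phi' -> tr2 psi psi' -> tr2 (comp_form phi psi) chi ->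
  induces_map phi f -> induces_map psi h ->
  induces_map phi' f' -> induces_map psi' h' ->
  induces_map chi (h' \o f').

(* The image of the arrow from the empty set is determined, since homs from the
   empty set are singletons. *)
Definition is_translation_functor (F : functor (PLS A sc) (PLS B sc)) : Prop :=
  [/\ [/\ F1, F2, F3 & F4], [/\ F5, F6 & F7],
      F None = None,
      forall m (x : plset A sc m) S E T E',
        tr_presentation S E T E' ->
        oX x = Vset S -> @oR _ _ _ _ x = erel E (Vset S) ->
        exists x' : plset B sc (m * d),
          [/\ F (plob x) = plob x', oX x' = Vset T &
              @oR _ _ _ _ x' = erel E' (Vset T)] &
      forall m s (x : plset A sc m) (y : plset A sc s) (f : fmap x y) phi phi',
        induces_map phi (sval f) -> tr2 phi phi' ->
        exists (x' : plset B sc (m * d)) (y' : plset B sc (s * d)) (f' : fmap x' y'),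
          @arrow (PLS B sc) _ _ (@fhom _ _ F (plob x) (plob y) f) =
            @arrow (PLS B sc) (plob x') (plob y') f' /\
          induces_map phi' (sval f')].
End Translation.

Section Classes.
Variables (LA LB : language) (A : structure LA) (B : structure LB).
Variable sc : size_class.

(* The class Tr, and the class Int for the size class without restriction *)
Definition Tr (F : functor (PLS A sc) (PLS B sc)) : Prop :=
  exists d k (G : code LA LB d k) p g, is_translation_functor G p g F.

Definition Tr_inj (H : functor (LS A sc) (LS B sc)) : Prop :=
  exists d k (G : code LA LB d k) p g F,
  [/\ injective_code G, is_translation_functor G p g F &
      functor_eq (fcomp (LS_incl B sc) H) (fcomp F (LS_incl A sc))].
End Classes.

Definition PDS L (A : structure L) : category := PLS A Finite_systems.
Definition DS L (A : structure L) : category := LS A Finite_systems.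

(* Main.v *)
From Stdlib Require Import List.
From mathcomp Require Import all_boot.
From mathcomp Require Import boolp classical_sets cardinality.
Require Import Defs.

(** All five conditions say that there is a bijection [m : B -> A] which is
    definable in both directions: the code of [A] in [B] has dimension one, its
    domain is the whole of [B], and [m] is its coordinate map; the same holds
    for the inverse of [m] with [A] and [B] exchanged ([definably_bijective]).

    Syntactic isomorphism.  If a composition of two interpretations equals the
    identical interpretation, then the product of the dimensions is one, every
    element lies in the domains, and the coordinate maps are inverse to each
    other ([syn_definably_bijective]).  Conversely, the reduction theorem
    ([reduction]) says that a translated formula holds at a tuple exactly when
    the formula holds at its image under the coordinate map.  Applied to the
    formulas of a code, it shows that the composite code of a bijection and its
    inverse defines the identical structure ([definably_bijective_syn]).

    From the bijection to the functors.  Naming [a] by its preimage under [m],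
    the translation of a formula defines the preimage under [m] of the set that
    the formula defines.  So the translation functor takes preimages of sets,
    equivalence relations and graphs, which makes F1-F7 evident
    ([bijection_functor_translation]), and the functors of [m] and of its
    inverse are inverse to each other ([bijection_functorK]).  Since [m] is
    injective, the formula E of its code may be taken to be equality.

    From the functors to the bijection.  Let [g] and [h] be the maps of the two
    extended codes.  As the composite functor fixes an object of dimension one,
    both codes have dimension one.  By F2 the translation of systems induces a
    map on the non-empty logical sets, which is monotone because a union of
    systems defines an intersection; this map has a monotone inverse.  Hence
    the universe corresponds to the universe and minimal sets to minimal sets:
    the point [a] goes to a single point, which is [g a] because the
    translation of [x = a] holds there ([point_translation]).  So [g] and [h]
    are inverse bijections.  Finally an atomic formula holds at a tuple [a] iff
    it is consistent with the equations [x_i = a_i]; by F1 this is so iff the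
    translated system is consistent, and its only possible solution is the
    image of [a] under [g] ([atom_translation]).  This says that the code of
    [A] in [B] represents [A] through the inverse of [g].

    Translations are defined on normal forms and for formulas whose parameters
    have been listed, so they exist because every formula has an unnested
    prenex normal form ([nform_exists]) and finitely many parameters
    ([finite_params]). *)

Set Implicit Arguments.
Unset Strict Implicit.
Unset Printing Implicit Defensive.

Local Open Scope classical_set_scope.

(** * Finite conjunctions and disjunctions *)

Lemma sat_foldl_and L T (o : ops L T) V (rho : V -> T) (s : seq (formula L V)) p :
  sat_ops o (foldl (@Fand L V) p s) rho <->
  sat_ops o p rho /\ List.Forall (fun q => sat_ops o q rho) s.
Proof.
elim: s p => [|q s IH] p /=; first by split=> [|[]].
rewrite IH /= List.Forall_cons_iff; tauto.
Qed.

Lemma sat_foldl_or L T (o : ops L T) V (rho : V -> T) (s : seq (formula L V)) p :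
  sat_ops o (foldl (@For L V) p s) rho <->
  sat_ops o p rho \/ List.Exists (fun q => sat_ops o q rho) s.
Proof.
elim: s p => [|q s IH] p /=; first by rewrite List.Exists_nil; tauto.
rewrite IH /= List.Exists_cons; tauto.
Qed.

Lemma sat_fands_enum L T (o : ops L T) V (rho : V -> T) (I : finType)
    (f : I -> formula L V) :
  sat_ops o (fands [seq f i | i <- enum I]) rho <-> forall i, sat_ops o (f i) rho.
Proof.
have H (s : seq I) : sat_ops o (fands [seq f i | i <- s]) rho <->
    forall i, i \in s -> sat_ops o (f i) rho.
  case: s => [|x s] //=; rewrite sat_foldl_and Forall_map Forall_forall.
  split=> [[Hx Hs] i|Hs].
    rewrite inE => /orP[/eqP->//|si]; apply: Hs.
    elim: s si => //= y s IH; rewrite inE => /orP[/eqP->|/IH]; tauto.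
  split; first by apply: Hs; rewrite mem_head.
  move=> i si; apply: Hs; rewrite inE; apply/orP; right.
  elim: s si => //= y s IH [->|/IH]; rewrite ?mem_head // inE => ->.
  by rewrite orbT.
by rewrite H; split=> h i; [apply: h; rewrite mem_enum|move=> _; exact: h].
Qed.

Definition literal_form L V L' W (at_ : uatom L V -> formula L' W) (l : literal L V) :=
  if l.1 then at_ l.2 else Fnot (at_ l.2).

Lemma sat_matrix L V L' W (at_ : uatom L V -> formula L' W) T (o : ops L' T)
    (rho : W -> T) (m : matrix L V) :
  sat_ops o (matrix_form at_ m) rho <->
  List.Exists (fun c : nelist (literal L V) =>
    List.Forall (fun l => sat_ops o (literal_form at_ l) rho) (c.1 :: c.2))
  (m.1 :: m.2).
Proof.
have H : (fun c : nelist (literal L V) =>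
      sat_ops o (nefold (@Fand L' W) (literal_form at_) c) rho) =
    fun c => List.Forall (fun l => sat_ops o (literal_form at_ l) rho) (c.1 :: c.2).
  apply: funext => c; apply: propext.
  by rewrite /nefold sat_foldl_and Forall_map Forall_cons_iff.
by rewrite -H Exists_cons /matrix_form {1}/nefold sat_foldl_or Exists_map.
Qed.

(** * Prenex normal forms *)

(** What a formula says, uniformly in all structures.  Normal forms are
    constructed for such predicates, so that they can be combined without
    manipulating formulas up to logical equivalence. *)
Definition upred L V := forall M : structure L, (V -> M) -> Prop.

Definition has_dnf L V (R : upred L V) := exists m : matrix L V,
  forall (M : structure L) (rho : V -> M),
    sat_ops M (matrix_form (@uatom_form L V) m) rho <-> R M rho.

Definition has_nform L V (R : upred L V) := exists n : nform L V,
  forall (M : structure L) (rho : V -> M), sat_ops M (nform_form n) rho <-> R M rho.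

Definition conj_holds L V (c : nelist (literal L V)) : upred L V :=
  fun M rho => List.Forall
    (fun l => sat_ops M (literal_form (@uatom_form L V) l) rho) (c.1 :: c.2).

Lemma has_dnf_ext L V (R R' : upred L V) :
  (forall M rho, R M rho <-> R' M rho) -> has_dnf R -> has_dnf R'.
Proof. by move=> RR' [m hm]; exists m => M rho; rewrite hm. Qed.

Lemma has_nform_ext L V (R R' : upred L V) :
  (forall M rho, R M rho <-> R' M rho) -> has_nform R -> has_nform R'.
Proof. by move=> RR' [m hm]; exists m => M rho; rewrite hm. Qed.

Lemma has_dnf_conj L V (c : nelist (literal L V)) : has_dnf (conj_holds c).
Proof.
exists (c, [::]) => M rho; rewrite sat_matrix Exists_cons Exists_nil /=.
by rewrite /conj_holds; tauto.
Qed.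

Lemma has_dnf_or L V (R R' : upred L V) : has_dnf R -> has_dnf R' ->
  has_dnf (fun M rho => R M rho \/ R' M rho).
Proof.
move=> [m hm] [m' hm']; exists (m.1, m.2 ++ m'.1 :: m'.2) => M rho.
by rewrite -hm -hm' !sat_matrix -Exists_app.
Qed.

(** A disjunctive normal form is a disjunction of conjunctions, so closure
    properties of [has_dnf] need only be checked on single conjunctions when
    they commute with disjunction. *)
Lemma has_dnf_ind L V (P : upred L V -> Prop) :
  (forall R R', (forall M rho, R M rho <-> R' M rho) -> P R -> P R') ->
  (forall c, P (conj_holds c)) ->
  (forall R R', P R -> P R' -> P (fun M rho => R M rho \/ R' M rho)) ->
  forall R, has_dnf R -> P R.
Proof.
move=> Pext Pconj Por R [[c s] hm].
suff H : P (fun M rho => List.Exists (fun c => conj_holds c rho) (c :: s)).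
  by apply: Pext H => M rho; rewrite -hm sat_matrix.
elim: s c {hm} => [|c' s IH] c.
  by apply: Pext (Pconj c) => M rho; rewrite Exists_cons Exists_nil; tauto.
apply: Pext (Por _ _ (Pconj c) (IH c')) => M rho.
by rewrite [X in _ <-> X]Exists_cons.
Qed.

Lemma has_dnf_and L V (R R' : upred L V) : has_dnf R -> has_dnf R' ->
  has_dnf (fun M rho => R M rho /\ R' M rho).
Proof.
move=> hR hR'; move: R hR; apply: has_dnf_ind.
- by move=> R1 R2 e; apply: has_dnf_ext => M rho; rewrite e.
- move=> c; move: R' hR'; apply: has_dnf_ind.
  + by move=> R1 R2 e; apply: has_dnf_ext => M rho; rewrite e.
  + move=> c'; apply: has_dnf_ext (has_dnf_conj (c.1, c.2 ++ c'.1 :: c'.2)).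
    by move=> M rho; rewrite /conj_holds -Forall_app.
  + move=> R1 R2 h1 h2; apply: has_dnf_ext (has_dnf_or h1 h2) => M rho; tauto.
- move=> R1 R2 h1 h2; apply: has_dnf_ext (has_dnf_or h1 h2) => M rho; tauto.
Qed.

Lemma has_dnf_lit L V b (a : uatom L V) :
  has_dnf (fun M rho => sat_ops M (literal_form (@uatom_form L V) (b, a)) rho).
Proof.
apply: has_dnf_ext (has_dnf_conj ((b, a), [::])) => M rho.
by rewrite /conj_holds Forall_cons_iff; split=> [[]|].
Qed.

Lemma has_dnf_not L V (R : upred L V) : has_dnf R ->
  has_dnf (fun M rho => ~ R M rho).
Proof.
move: R; apply: has_dnf_ind.
- by move=> R1 R2 e; apply: has_dnf_ext => M rho; rewrite e.
- move=> [[b a] s].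
  have neg b' a' : has_dnf (fun M rho =>
      ~ sat_ops M (literal_form (@uatom_form L V) (b', a')) rho).
    apply: has_dnf_ext (has_dnf_lit (~~ b') a') => M rho.
    by case: b' => //=; rewrite notE.
  elim: s b a => [|[b' a'] s IH] b a.
    apply: has_dnf_ext (neg b a) => M rho.
    by rewrite /conj_holds Forall_cons_iff; split=> [n []|n h] //; apply: n.
  apply: has_dnf_ext (has_dnf_or (neg b a) (IH b' a')) => M rho.
  by rewrite /conj_holds [X in _ <-> ~ X]Forall_cons_iff not_andE.
- move=> R1 R2 h1 h2; apply: has_dnf_ext (has_dnf_and h1 h2) => M rho; tauto.
Qed.

Definition uatom_rename L V W (h : V -> W) (a : uatom L V) : uatom L W :=
  match a with
  | Ueq x y => Ueq L (h x) (h y)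
  | Ucst x c => Ucst (h x) c
  | Ufun f x => Ufun (h \o x)
  | Urel r x => Urel (h \o x)
  end.

Lemma has_dnf_rename L V W (h : V -> W) (R : upred L V) : has_dnf R ->
  has_dnf (fun M rho => R M (rho \o h)).
Proof.
move: R; apply: has_dnf_ind.
- by move=> R1 R2 e; apply: has_dnf_ext => M rho; rewrite e.
- move=> [l s]; pose lr (l : literal L V) := (l.1, uatom_rename h l.2).
  apply: has_dnf_ext (has_dnf_conj (lr l, List.map lr s)) => M rho.
  rewrite /conj_holds (Forall_map lr _ (l :: s)) /=.
  by split; apply: Forall_impl => -[[] []].
- by move=> R1 R2; apply: has_dnf_or.
Qed.

Lemma has_nform_dnf L V (R : upred L V) : has_dnf R -> has_nform R.
Proof. by move=> [m hm]; exists (Nmat m). Qed.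

Lemma has_nform_uatom L V (a : uatom L V) :
  has_nform (fun M rho => sat_ops M (uatom_form a) rho).
Proof. exact/has_nform_dnf/(has_dnf_lit true). Qed.

Lemma has_nform_ex L V (R : upred L (option V)) : has_nform R ->
  has_nform (fun M rho => exists a, R M (ocons a rho)).
Proof.
move=> [n hn]; exists (Nex n) => M rho /=.
by split=> -[a h]; exists a; apply/hn.
Qed.

Lemma has_nform_all L V (R : upred L (option V)) : has_nform R ->
  has_nform (fun M rho => forall a, R M (ocons a rho)).
Proof. by move=> [n hn]; exists (Nall n) => M rho /=; split=> h a; apply/hn. Qed.

Lemma has_nform_ind L (P : forall V, upred L V -> Prop) :
  (forall V R R', (forall M rho, R M rho <-> R' M rho) -> P V R -> P V R') ->
  (forall V R, has_dnf R -> P V R) ->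
  (forall V R, P (option V) R -> P V (fun M rho => exists a, R M (ocons a rho))) ->
  (forall V R, P (option V) R -> P V (fun M rho => forall a, R M (ocons a rho))) ->
  forall V R, has_nform R -> P V R.
Proof.
move=> Pext Pdnf Pex Pall V R [n hn].
apply: Pext hn _; elim: n {R} => {}V.
- by move=> m; apply: Pdnf; exists m.
- by move=> n /Pex.
- by move=> n /Pall.
Qed.

Lemma has_nform_rename L V W (h : V -> W) (R : upred L V) : has_nform R ->
  has_nform (fun M rho => R M (rho \o h)).
Proof.
have oc (U X T : Type) (k : U -> X) (a : T) rho :
    ocons a rho \o omap k = ocons a (rho \o k) by apply: funext => -[].
move=> hR; move: V R hR W h.
apply: (@has_nform_ind L (fun V R => forall W (h : V -> W),
  has_nform (fun M rho => R M (rho \o h)))) => V R.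
- by move=> R' e hR W h; apply: has_nform_ext (hR W h) => M rho; exact: e.
- by move=> hR W h; apply/has_nform_dnf/has_dnf_rename.
- move=> hR W h; apply: has_nform_ext (has_nform_ex (hR _ (omap h))) => M rho.
  by split=> -[a]; rewrite ?oc => H; exists a => //; rewrite oc.
- move=> hR W h; apply: has_nform_ext (has_nform_all (hR _ (omap h))) => M rho.
  by split=> H a; move: (H a); rewrite oc.
Qed.

Lemma has_nform_not L V (R : upred L V) : has_nform R ->
  has_nform (fun M rho => ~ R M rho).
Proof.
move: V R; apply: (@has_nform_ind L
  (fun V R => has_nform (fun M rho => ~ R M rho))) => V R.
- by move=> R' e; apply: has_nform_ext => M rho; rewrite e.
- by move=> hR; apply/has_nform_dnf/has_dnf_not.
- by move=> /has_nform_all; apply: has_nform_ext => M rho; rewrite -forallNE.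
- by move=> /has_nform_ex; apply: has_nform_ext => M rho; rewrite -existsNE.
Qed.

(** The quantifiers of the first formula are moved to the front, then those of
    the second one. *)
Lemma has_nform_and L V (R R' : upred L V) : has_nform R -> has_nform R' ->
  has_nform (fun M rho => R M rho /\ R' M rho).
Proof.
move=> hR; move: V R hR R'; apply: (@has_nform_ind L (fun V R => forall R',
    has_nform R' -> has_nform (fun M rho => R M rho /\ R' M rho))) => V R.
- by move=> R1 e hR R' hR'; apply: has_nform_ext (hR R' hR') => M rho; rewrite e.
- move=> hR R' hR'; move: V R' hR' R hR.
  apply: (@has_nform_ind L (fun V R' => forall R,
      has_dnf R -> has_nform (fun M rho => R M rho /\ R' M rho))) => V R'.
  + by move=> R1 e hR' R hR; apply: has_nform_ext (hR' R hR) => M rho; rewrite e.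
  + by move=> hR' R hR; apply/has_nform_dnf/has_dnf_and.
  + move=> IH R hR.
    apply: has_nform_ext (has_nform_ex (IH _ (has_dnf_rename Some hR))) => M rho.
    by split=> [[a [h k]]|[h [a k]]]; [split=> //; exists a|exists a].
  + move=> IH R hR.
    apply: has_nform_ext (has_nform_all (IH _ (has_dnf_rename Some hR))) => M rho.
    (* a conjunct leaves the scope of a universal quantifier only because
       structures are non-empty *)
    case: (carrier_inhabited M) => a0.
    by split=> [h|[h k] a //]; split=> [|a]; [case: (h a0)|case: (h a)].
- move=> IH R' hR'.
  apply: has_nform_ext (has_nform_ex (IH _ (has_nform_rename Some hR'))) => M rho.
  by split=> [[a [h k]]|[[a h] k]]; [split=> //; exists a|exists a].
- move=> IH R' hR'.
  apply: has_nform_ext (has_nform_all (IH _ (has_nform_rename Some hR'))) => M rho.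
  case: (carrier_inhabited M) => a0.
  by split=> [h|[h k] a //]; split=> [a|]; [case: (h a)|case: (h a0)].
Qed.

Lemma has_nform_or L V (R R' : upred L V) : has_nform R -> has_nform R' ->
  has_nform (fun M rho => R M rho \/ R' M rho).
Proof.
move=> hR hR'.
apply: has_nform_ext
  (has_nform_not (has_nform_and (has_nform_not hR) (has_nform_not hR'))) => M rho.
by rewrite not_andE !notE.
Qed.

Lemma has_nform_imp L V (R R' : upred L V) : has_nform R -> has_nform R' ->
  has_nform (fun M rho => R M rho -> R' M rho).
Proof.
move=> hR hR'; apply: has_nform_ext (has_nform_or (has_nform_not hR) hR') => M rho.
by rewrite implyE.
Qed.

Lemma has_nform_true L V : has_nform (fun (M : structure L) (rho : V -> M) => True).
Proof.
(* [V] may be empty, so the atom needs a bound variable *)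
apply: has_nform_ext (has_nform_ex (has_nform_uatom (Ueq L None None))) => M rho.
by split=> // _; case: (carrier_inhabited M) => a; exists a.
Qed.

Lemma has_nform_forall_ord L V n (R : 'I_n -> upred L V) :
  (forall i, has_nform (R i)) -> has_nform (fun M rho => forall i, R i M rho).
Proof.
elim: n R => [|n IH] R hR.
  by apply: has_nform_ext (has_nform_true _ _) => M rho; split=> // _ [].
apply: has_nform_ext
  (has_nform_and (hR ord0) (IH _ (fun i => hR (lift ord0 i)))) => M rho.
split=> [[h0 h] i|h]; last by split.
by case: (unliftP ord0 i) => [j|] ->.
Qed.

Lemma has_nform_exs L V n (R : upred L (V + 'I_n)) : has_nform R ->
  has_nform (fun M rho => exists b : tup M n, R M (sumcase rho b)).
Proof.
elim: n V R => [|n IH] V R hR.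
  pose h : V + 'I_0 -> V :=
    sumcase id (fun i : 'I_0 => False_rect V (notF (ltn_ord i))).
  apply: has_nform_ext (has_nform_rename h hR) => M rho.
  have e b : rho \o h = sumcase rho b by apply: funext => -[//|[]].
  split=> [H|[b]]; last by rewrite (e b).
  by exists (fun i : 'I_0 => False_rect M (notF (ltn_ord i))); rewrite -e.
apply: has_nform_ext
  (IH _ _ (has_nform_ex (has_nform_rename (@block_var V n) hR))) => M rho.
split=> [[b [a H]]|[b H]].
  exists (fun i => if unlift ord0 i is Some j then b j else a).
  congr (R M _): H; apply: funext => -[v|i] //=.
  by case: (unlift ord0 i).
exists (b \o lift ord0), (b ord0).
congr (R M _): H; apply: funext => -[v|i] //=.
by case: unliftP => [j|] ->.
Qed.

(** Unnesting: the value of a term is definable by existentially quantifying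
    over the values of its immediate subterms. *)
Lemma has_nform_term L V (t : term L V) :
  has_nform (fun M rho => eval M (rho \o Some) t = rho None).
Proof.
elim: t => [v|c|f ts IH].
- exact: has_nform_uatom (Ueq L (Some v) None).
- apply: has_nform_ext (has_nform_uatom (Ucst None c)) => M rho /=.
  by split=> ->.
pose x i := if unlift ord0 i is Some j then inr j else inl None : option V + 'I_(far f).
pose y i (o : option V) : option V + 'I_(far f) :=
  if o is Some v then inl (Some v) else inr i.
apply: has_nform_ext (has_nform_exs (has_nform_and
  (has_nform_forall_ord (fun i => has_nform_rename (y i) (IH i)))
  (has_nform_uatom (Ufun x)))) => M rho /=; rewrite /x unlift_none /=.
have e b : ifun M (fun i : 'I_(far f) =>
    sumcase rho b (if unlift ord0 (lift ord0 i) is Some j then inr j else inl None)) =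
    ifun M b by congr ifun; apply: funext => i; rewrite liftK.
split=> [[b [hb]]|h].
  by rewrite e => <-; congr ifun; apply: funext => i; exact: hb.
exists (fun i => eval M (rho \o Some) (ts i)); split=> //.
by rewrite e.
Qed.

Lemma nform_exists L V (phi : formula L V) :
  has_nform (fun M rho => sat_ops M phi rho).
Proof.
elim: phi => {}V /=.
- exact: has_nform_true.
- move=> t u; apply: has_nform_ext
    (has_nform_ex (has_nform_and (has_nform_term t) (has_nform_term u))) => M rho.
  by split=> [[a [/= -> ->]]|h] //; exists (eval M rho u).
- move=> r ts.
  pose y i (o : option V) : V + 'I_(rar r) := if o is Some v then inl v else inr i.
  apply: has_nform_ext (has_nform_exs (has_nform_and
    (has_nform_forall_ord (fun i => has_nform_rename (y i) (has_nform_term (ts i))))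
    (has_nform_uatom (Urel (fun i => inr i))))) => M rho /=.
  split=> [[b [hb]]|h].
    by congr irel; apply: funext => i; exact: esym (hb i).
  by exists (fun i => eval M rho (ts i)).
- by move=> p; apply: has_nform_not.
- by move=> p hp q hq; apply: has_nform_and.
- by move=> p hp q hq; apply: has_nform_or.
- by move=> p hp q hq; apply: has_nform_imp.
- by move=> p; apply: has_nform_ex.
- by move=> p; apply: has_nform_all.
Qed.

(** * Translations exist *)

Lemma normal_form_exists L V (phi : formula L V) : exists n, normal_form_of phi n.
Proof.
have [[n ->]|nphi] := pselect (normal phi); first by exists n; left.
have [n hn] := nform_exists phi.
by exists n; right; split=> // M rho; rewrite /sat hn.
Qed.

Lemma translation_exists LA LB d k (G : code LA LB d k) (V : finType)
    (phi : formula LA V) : exists chi, is_translation G phi chi.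
Proof. by have [n hn] := normal_form_exists phi; exists (tr G n), n. Qed.

Lemma sat_normal_form L (M : structure L) V (phi : formula L V) n (rho : V -> M) :
  normal_form_of phi n -> sat_ops M (nform_form n) rho <-> sat_ops M phi rho.
Proof. by case=> [->//|[_ /(_ M rho)]]; rewrite /sat => ->. Qed.

Lemma inst_term_rename L P V W X (s : W -> X + P) (h : V -> W) (t : term L V) :
  inst_term s (rename_term h t) = inst_term (s \o h) t.
Proof. by elim: t => //= f ts IH; congr Tfun; apply: funext => i. Qed.

Lemma inst_rename L P V W X (s : W -> X + P) (h : V -> W) (phi : formula L V) :
  inst s (rename h phi) = inst (s \o h) phi.
Proof.
have up U U' Y (u : U' -> Y + P) (l : U -> U') :
  inst_up u \o omap l = inst_up (u \o l) by apply: funext => -[].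
elim: phi W X s h => //= {}V.
- by move=> t u *; rewrite !inst_term_rename.
- by move=> r ts *; congr Frel; apply: funext => i; rewrite inst_term_rename.
- by move=> p IH *; rewrite IH.
- by move=> p IHp q IHq *; rewrite IHp IHq.
- by move=> p IHp q IHq *; rewrite IHp IHq.
- by move=> p IHp q IHq *; rewrite IHp IHq.
- by move=> p IH *; rewrite IH up.
- by move=> p IH *; rewrite IH up.
Qed.

Definition name_params P V s (a : tup P s) : V + 'I_s -> V + P :=
  sumcase inl (fun i => inr (a i)).

(** [Q] holds of every tuple that lists certain finitely many parameters.  It is
    required of all such tuples, not of one of them, so that two subformulas can
    be treated with a common list of parameters. *)
Definition finitely_supported P (Q : forall s, tup P s -> Prop) :=
  exists l : seq P, forall s (a : tup P s),
    (forall x, List.In x l -> exists i, a i = x) -> Q s a.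

Lemma finitely_supported_true P (Q : forall s, tup P s -> Prop) :
  (forall s a, Q s a) -> finitely_supported Q.
Proof. by move=> h; exists [::]. Qed.

Lemma finitely_supported_and P (Q1 Q2 Q : forall s, tup P s -> Prop) :
  (forall s a, Q1 s a -> Q2 s a -> Q s a) ->
  finitely_supported Q1 -> finitely_supported Q2 -> finitely_supported Q.
Proof.
move=> h [l1 h1] [l2 h2]; exists (l1 ++ l2) => s a ha.
by apply: h; [apply: h1|apply: h2] => x xl; apply: ha; rewrite in_app_iff; tauto.
Qed.

Lemma finitely_supported_forall P n (Q1 : 'I_n -> forall s, tup P s -> Prop)
    (Q : forall s, tup P s -> Prop) :
  (forall s a, (forall i, Q1 i s a) -> Q s a) ->
  (forall i, finitely_supported (Q1 i)) -> finitely_supported Q.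
Proof.
move=> h /choice[l hl]; exists (List.flat_map l (enum 'I_n)) => s a ha.
apply: h => i; apply: hl => x xl; apply: ha; apply/in_flat_map; exists i.
split=> //; have : i \in enum 'I_n by rewrite mem_enum.
by elim: (enum _) => //= j r IH; rewrite inE => /orP[/eqP->|/IH]; [left|right].
Qed.

Lemma finitely_supported_injective P (Q : forall s, tup P s -> Prop) :
  finitely_supported Q -> exists s (a : tup P s), injective a /\ Q s a.
Proof.
move=> [l hl]; pose u : seq {classic P} := undup (l : seq {classic P}).
exists (size u), (tnth (in_tuple u)); split.
  have h : injective (tnth (in_tuple u)) by apply/tuple_uniqP; rewrite /= undup_uniq.
  exact: h.
apply: hl => x xl; have xu : (x : {classic P}) \in u.
  rewrite mem_undup; elim: l xl {u} => //= y l IH [->|/IH]; rewrite ?mem_head //.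
  by rewrite inE => ->; rewrite orbT.
by have /tnthP[i ->] : (x : {classic P}) \in in_tuple u by []; exists i.
Qed.

Lemma finite_params_term L P V (t : term (expand L P) V) :
  finitely_supported (fun s a => exists t0, t = inst_term (name_params a) t0).
Proof.
elim: t => [v|[c|x]|f ts IH].
- by apply: finitely_supported_true => s a; exists (Tvar (inl v)).
- by apply: finitely_supported_true => s a; exists (Tcst c).
- exists [:: x] => s a /(_ x)[|i <-]; first by left.
  by exists (Tvar (inr i)).
- apply: finitely_supported_forall IH => s a /choice[t0 ht].
  exists (@Tfun L _ f t0) => /=; congr Tfun; exact: funext.
Qed.

(** Under a quantifier the bound variable has to be the outermost one, outside of
    the variables that stand for parameters. *)
Definition opt_shift V X (z : option V + X) : option (V + X) :=
  match z with
  | inl (Some v) => Some (inl v)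
  | inl None => None
  | inr x => Some (inr x)
  end.

Lemma inst_opt_shift L P V s (a : tup P s) (phi : formula L (option V + 'I_s)) :
  inst (inst_up (name_params (V := V) a)) (rename (@opt_shift V _) phi) =
  inst (name_params a) phi.
Proof. by rewrite inst_rename; congr inst; apply: funext => -[[v|]|]. Qed.

(** A formula with parameters is an instance of a formula without parameters,
    by induction: every term and formula has finitely many immediate parts. *)
Lemma finite_params L P V (psi : formula (expand L P) V) :
  finitely_supported (fun s a => exists phi, psi = inst (name_params a) phi).
Proof.
elim: psi => {}V.
- by apply: finitely_supported_true => s a; exists Ftrue.
- move=> t u; apply: finitely_supported_and (finite_params_term t)
    (finite_params_term u) => s a [t0 ->] [u0 ->].
  by exists (Feq t0 u0).
- move=> r ts; apply: finitely_supported_forall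
    (fun i => finite_params_term (ts i)) => s a /choice[t0 ht].
  by exists (@Frel L _ r t0) => /=; congr Frel; exact: funext.
- by move=> p [l h]; exists l => s a /h[p0 ->]; exists (Fnot p0).
- move=> p hp q hq; apply: finitely_supported_and hp hq => s a [p0 ->] [q0 ->].
  by exists (Fand p0 q0).
- move=> p hp q hq; apply: finitely_supported_and hp hq => s a [p0 ->] [q0 ->].
  by exists (For p0 q0).
- move=> p hp q hq; apply: finitely_supported_and hp hq => s a [p0 ->] [q0 ->].
  by exists (Fimp p0 q0).
- move=> p [l h]; exists l => s a /h[p0 ->]; exists (Fex (rename (@opt_shift _ _) p0)).
  by rewrite /= inst_opt_shift.
- move=> p [l h]; exists l => s a /h[p0 ->]; exists (Fall (rename (@opt_shift _ _) p0)).
  by rewrite /= inst_opt_shift.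
Qed.

Lemma ext_translation_exists LA LB (A : structure LA) (B : structure LB) d k
    (G : code LA LB d k) (p : tup B k) (g : A -> tup B d)
    (V : finType) (W : Type) (h : V * 'I_d -> W) (psi : aform A V) :
  exists chi, is_ext_translation G p g h psi chi.
Proof.
have [s [a [ia [phi ->]]]] := finitely_supported_injective (finite_params psi).
have [chi hchi] := translation_exists G (phi : formula LA (V + 'I_s)%type).
by eexists; exists s, a, phi, chi; split.
Qed.

Lemma trset_exists LA LB (A : structure LA) (B : structure LB) d k
    (G : code LA LB d k) (p : tup B k) (g : A -> tup B d) m
    (S : set (aform A 'I_m)) : exists T, trset G p g S T.
Proof.
have [tau htau] := choice (fun psi : aform A 'I_m =>
  ext_translation_exists G p g (@blk1 m d) psi).
by exists (tau @` S); exists tau => // psi _; exact: htau.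
Qed.

(** * Semantics of translations *)

Lemma eval_inst L T (o : ops L T) V W (s : V -> W + T) (t : term L V) rho :
  eval (expand_ops o) rho (inst_term s t) = eval o (sumcase rho id \o s) t.
Proof.
elim: t => //= [v|f ts IH]; first by case: (s v).
by congr ifun; apply: funext.
Qed.

Lemma sat_inst L T (o : ops L T) V W (s : V -> W + T) (phi : formula L V) rho :
  sat_ops (expand_ops o) (inst s phi) rho <-> sat_ops o phi (sumcase rho id \o s).
Proof.
have oc U X (u : U -> X + T) (x : X -> T) a :
    sumcase (ocons a x) id \o inst_up u = ocons a (sumcase x id \o u).
  by apply: funext => -[v|] //=; case: (u v).
elim: phi W s rho => //= {}V.
- by move=> t u *; rewrite !eval_inst.
- move=> r ts W s rho; rewrite (_ : (fun i => eval _ rho _) =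
    (fun i => eval o (sumcase rho id \o s) (ts i))) //.
  by apply: funext => i; rewrite eval_inst.
- by move=> p IH *; rewrite IH.
- by move=> p IHp q IHq *; rewrite IHp IHq.
- by move=> p IHp q IHq *; rewrite IHp IHq.
- by move=> p IHp q IHq *; rewrite IHp IHq.
- by move=> p IH W s rho; split=> -[a h]; exists a; move: h; rewrite IH oc.
- by move=> p IH W s rho; split=> h a; move: (h a); rewrite IH oc.
Qed.

Lemma sat_falls L T (o : ops L T) V n (phi : formula L (V + 'I_n)) (rho : V -> T) :
  sat_ops o (falls phi) rho <-> forall b : tup T n, sat_ops o phi (sumcase rho b).
Proof.
rewrite /falls; elim: n V phi rho => [|n IH] V phi rho /=.
  rewrite sat_rename; split=> [H b|H].
    by congr (sat_ops o phi _): H; apply: funext => -[//|[]].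
  congr (sat_ops o phi _): (H (fun i : 'I_0 => False_rect T (notF (ltn_ord i)))).
  by apply: funext => -[//|[]].
rewrite IH /=; split=> H.
  move=> b; move: (H (b \o lift ord0) (b ord0)); rewrite sat_rename => K.
  by congr (sat_ops o phi _): K; apply: funext => -[v|i] //=;
    case: unliftP => [j|] ->.
move=> b a; rewrite sat_rename.
have K := H (fun i => if unlift ord0 i is Some j then b j else a).
by congr (sat_ops o phi _): K; apply: funext => -[v|i] //=;
  case: (unlift ord0 i).
Qed.

Definition env T V d k (bb : V -> tup T d) (p : tup T k) : V * 'I_d + 'I_k -> T :=
  sumcase (fun z => bb z.1 z.2) p.

Lemma env_at_vars T V d k n (x : 'I_n -> V) (bb : V -> tup T d) (p : tup T k) :
  env bb p \o at_vars x = env (bb \o x) p.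
Proof. by apply: funext => -[]. Qed.

Section TranslationSemantics.
Variables (LA LB : language) (B : structure LB) (d k : nat).
Variables (G : code LA LB d k) (p : tup B k).

Definition uatom_csat V (a : uatom LA V) (bb : V -> tup B d) : Prop :=
  match a with
  | Ueq x y => csat p (cE G) (fun i : 'I_2 => if i == ord0 then bb x else bb y)
  | Ucst x c => csat p (cC G c) (fun=> bb x)
  | Ufun f x => csat p (cF G f) (bb \o x)
  | Urel r x => csat p (cR G r) (bb \o x)
  end.

Lemma sat_uatom_tr V (a : uatom LA V) (bb : V -> tup B d) :
  sat_ops B (uatom_tr G a) (env bb p) <-> uatom_csat a bb.
Proof.
case: a => [x y|x c|f x|r x] /=; rewrite sat_rename env_at_vars //.
rewrite /csat /sat (_ : bb \o _ = fun i => if i == ord0 then bb x else bb y) //.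
by apply: funext => i /=; case: ifP.
Qed.

Lemma sat_bound_U V (bb : V -> tup B d) c :
  sat_ops B (bound_U G V) (sumcase (env bb p) c) <-> code_U G p c.
Proof.
rewrite /bound_U sat_rename /code_U /mkset /csat /sat.
rewrite (_ : _ \o _ = sumcase (fun ij => c ij.2) p) //.
by apply: funext => -[].
Qed.

Lemma sat_bind_block V (bb : V -> tup B d) c phi :
  sat_ops B (rename (@bind_block d k V) phi) (sumcase (env bb p) c) <->
  sat_ops B phi (env (ocons c bb) p).
Proof.
rewrite sat_rename (_ : _ \o _ = env (ocons c bb) p) //.
by apply: funext => -[[[v|] j]|].
Qed.

Lemma sat_tr (V : finType) (n : nform LA V) (bb : V -> tup B d) :
  sat_ops B (tr G n) (env bb p) <->
  (forall v, code_U G p (bb v)) /\ sat_ops B (nform_tr G n) (env bb p).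
Proof.
rewrite /tr /= sat_fands_enum; apply: and_iff_compat_r.
by split=> h v; move: (h v); rewrite sat_rename env_at_vars.
Qed.

End TranslationSemantics.

(** [mu] is a coordinate map on the set defined by [U]: the code [G], read
    through [mu], says in [B] what the symbols of [LA] say in [A]. *)
Definition represents LA LB (A : structure LA) (B : structure LB) d k
    (G : code LA LB d k) (p : tup B k) (mu : tup B d -> A) : Prop :=
  let U := code_U G p in
  [/\ forall a, exists2 b, U b & mu b = a,
      forall b b', U b -> U b' ->
        csat p (cE G) (fun i : 'I_2 => if i == ord0 then b else b') <-> mu b = mu b',
      forall c b, U b -> csat p (cC G c) (fun=> b) <-> mu b = icst A c,
      forall f (b : 'I_(far f).+1 -> tup B d), (forall i, U (b i)) ->
        csat p (cF G f) b <->
        ifun A (fun i => mu (b (lift ord0 i))) = mu (b ord0) &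
      forall r (b : 'I_(rar r) -> tup B d), (forall i, U (b i)) ->
        csat p (cR G r) b <-> irel A (mu \o b)].

Section Reduction.
Variables (LA LB : language) (A : structure LA) (B : structure LB) (d k : nat).
Variables (G : code LA LB d k) (p : tup B k) (mu : tup B d -> A).
Hypothesis Gmu : represents G p mu.

(** The base of the reduction theorem: an unnested atom involves one symbol, whose
    formula in the code is read by the corresponding clause of [represents]. *)
Lemma represents_uatom V (a : uatom LA V) (bb : V -> tup B d) :
  (forall v, code_U G p (bb v)) ->
  uatom_csat G p a bb <-> sat_ops A (uatom_form a) (mu \o bb).
Proof.
move=> Ubb; case: Gmu => [_ hE hC hF hR].
case: a => [x y|x c|f x|r x] /=; first exact: hE.
- exact: hC.
- by rewrite hF //=.
- by apply: hR => i; exact: Ubb.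
Qed.

(** Quantifiers relativized to the domain of the code become quantifiers over [A]
    because the coordinate map is onto. *)
Lemma reduction_nform V (n : nform LA V) (bb : V -> tup B d) :
  (forall v, code_U G p (bb v)) ->
  sat_ops B (nform_tr G n) (env bb p) <-> sat_ops A (nform_form n) (mu \o bb).
Proof.
have mucons W c (cc : W -> tup B d) : ocons (mu c) (mu \o cc) = mu \o ocons c cc.
  by apply: funext => -[].
have Ucons W c (cc : W -> tup B d) : code_U G p c ->
    (forall v, code_U G p (cc v)) -> forall v, code_U G p (ocons c cc v).
  by move=> Uc Ucc [].
have [onto _ _ _ _] := Gmu.
elim: n bb => {}V /=.
- move=> m bb Ubb; rewrite !sat_matrix.
  have e l : sat_ops B (literal_form (uatom_tr G (V := V)) l) (env bb p) <->
      sat_ops A (literal_form (@uatom_form LA V) l) (mu \o bb).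
    by case: l => -[] a; rewrite /literal_form /= sat_uatom_tr represents_uatom.
  by split; apply: Exists_impl => c; apply: Forall_impl => l /e.
- move=> n IH bb Ubb; rewrite sat_fexs /=; split.
    move=> [c [/sat_bound_U Uc]]; rewrite sat_bind_block IH; last exact: Ucons.
    by exists (mu c); rewrite mucons.
  move=> [a]; have [c Uc <-] := onto a; rewrite mucons => h; exists c.
  by rewrite sat_bound_U sat_bind_block; split=> //; apply/IH => //; exact: Ucons.
- move=> n IH bb Ubb; rewrite sat_falls /=; split.
    move=> h a; have [c Uc <-] := onto a; rewrite mucons -IH; last exact: Ucons.
    by have := h c; rewrite sat_bound_U sat_bind_block; exact.
  move=> h c; rewrite sat_bound_U sat_bind_block => Uc.
  by rewrite IH -?mucons //; exact: Ucons.
Qed.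

Lemma reduction (V : finType) (phi : formula LA V) chi (bb : V -> tup B d) :
  is_translation G phi chi ->
  sat_ops B chi (env bb p) <->
  (forall v, code_U G p (bb v)) /\ sat_ops A phi (mu \o bb).
Proof.
move=> [n hn ->]; rewrite sat_tr.
by split=> -[Ubb]; rewrite reduction_nform // (sat_normal_form _ hn).
Qed.

(** The reduction theorem for formulas with parameters: the tuple [g a] stands
    for the parameter [a], since [mu] takes it back to [a]. *)
Lemma reduction_ext (g : A -> tup B d) (V : finType) W (h : V * 'I_d -> W)
    (psi : aform A V) (chi : aform B W) (rho : W -> B) :
  (forall a, code_U G p (g a)) -> (forall a, mu (g a) = a) ->
  is_ext_translation G p g h psi chi ->
  asat chi rho <->
  (forall v, code_U G p (fun j => rho (h (v, j)))) /\
  asat psi (fun v => mu (fun j => rho (h (v, j)))).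
Proof.
move=> Ug mug [s [a [phi [phi' [_ -> hphi ->]]]]].
rewrite /asat /sat !sat_inst.
pose bb := sumcase (fun v j => rho (h (v, j))) (fun i => g (a i)) : V + 'I_s -> tup B d.
rewrite (_ : _ \o _ = env bb p); last first.
  by apply: funext => -[[[v|i] j]|].
rewrite (reduction _ hphi) (_ : _ \o _ = mu \o bb); last first.
  by apply: funext => -[v|i] //=; rewrite mug.
apply: and_iff_compat_r; split=> [hb v|hb [v|i]]; [exact: (hb (inl v))|exact: hb|].
exact: Ug.
Qed.

End Reduction.

(** * Interpretations and coordinate maps *)

Lemma existT_inj T (P : T -> Type) x (u v : P x) : existT P x u = existT P x v -> u = v.
Proof.
move=> e; have := projT2_eq e.
by rewrite (Prop_irrelevance (projT1_eq e) erefl).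
Qed.

(** As [R] is symmetric and transitive on [X] alone, classes are well behaved
    only if [R] does not leave [X]. *)
Lemma cls_eqP T (X : set T) (R : T -> T -> Prop) a b (Xa : X a) (Xb : X b) :
  equivalence_on X R -> (forall a b, R a b -> X b) ->
  cls R Xa = cls R Xb <-> R a b.
Proof.
move=> [rR sR tR] RX; split=> [/(congr1 sval)/(congr1 (fun C => C b)) /= e|Rab].
  by rewrite /mkset in e; rewrite e; exact: rR.
apply: eq_exist => /=; apply/seteqP; split=> c /= h.
  by apply: (tR _ a) => //; [exact: RX h|exact: sR].
by apply: (tR _ b) => //; exact: RX h.
Qed.

Section InterpretationRepresents.
Variables (LA LB : language) (A : structure LA) (B : structure LB) (I : idata A B).

Lemma on_U_csat n (phi : formula LB (cvar (idim I) (ipdim I) n)) b :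
  (forall i, iU I (b i)) ->
  on_U (icode I) (ipar I) phi b <-> csat (ipar I) phi b.
Proof. by move=> Ub; split=> [[]|]. Qed.

Lemma qE_U b b' : qE (irealize I) b b' -> iU I b /\ iU I b'.
Proof. by move=> [h _]; split; [exact: (h ord0)|exact: (h ord_max)]. Qed.

Lemma qE_csat b b' : iU I b -> iU I b' ->
  qE (irealize I) b b' <->
  csat (ipar I) (cE (icode I)) (fun i : 'I_2 => if i == ord0 then b else b').
Proof. by move=> Ub Ub'; apply: on_U_csat => i; case: ifP. Qed.

(** The isomorphism that [imu I] induces on the quotient turns each equation
    between classes into an equation between values of [imu I]. *)
Lemma interpretation_represents : is_interpretation I ->
  represents (icode I) (ipar I) (imu I).
Proof.
move=> [o [[_ eqv [oC oF oR]] onto [mubar [bij isoC isoF isoR] hmu]]].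
have inj := bij_inj bij.
have hmuE b b' (Ub : iU I b) (Ub' : iU I b') :
    cls (qE (irealize I)) Ub = cls (qE (irealize I)) Ub' <-> imu I b = imu I b'.
  by rewrite -(hmu _ Ub) -(hmu _ Ub'); split=> [->|/inj].
split=> //.
- move=> b b' Ub Ub'; rewrite -qE_csat // -(hmuE _ _ Ub Ub').
  by rewrite cls_eqP // => x y /qE_U[].
- move=> c b Ub; rewrite -(hmu _ Ub) -isoC.
  apply: (iff_trans (iff_sym (@on_U_csat 1 _ (fun=> b) (fun=> Ub)))).
  apply: (iff_trans (oC c b Ub)); by split=> [->|/inj].
- move=> f b Ub; apply: (iff_trans (iff_sym (on_U_csat _ Ub))).
  apply: (iff_trans (oF f b Ub)); rewrite -(hmu _ (Ub ord0)).
  rewrite (_ : (fun i => _) = mubar \o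
    (fun i => cls (qE (irealize I)) (Ub (lift ord0 i)))); last first.
    by apply: funext => i; rewrite /= hmu.
  by rewrite -isoF; split=> [->|/inj].
- move=> r b Ub; apply: (iff_trans (iff_sym (on_U_csat _ Ub))).
  apply: (iff_trans (oR r b Ub)); rewrite isoR.
  rewrite (_ : imu I \o b = mubar \o
    (fun i => cls (qE (irealize I)) (Ub i))) //.
  by apply: funext => i; rewrite /= hmu.
Qed.

(** The structure on the quotient is transported from [A] along the bijection
    that [imu I] induces. *)
Lemma represents_interpretation : represents (icode I) (ipar I) (imu I) ->
  is_interpretation I.
Proof.
move=> [onto hE hC hF hR]; pose E := qE (irealize I); pose Q := quot (iU I) E.
have EP b b' : iU I b -> iU I b' -> E b b' <-> imu I b = imu I b'.
  by move=> Ub Ub'; rewrite -hE // -qE_csat.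
have eqv : equivalence_on (iU I) E.
  split=> [a Ua|a b Ua Ub|a b c Ua Ub Uc]; first exact/EP.
    by move=> /(EP _ _ Ua Ub) h; apply/EP.
  by move=> /(EP _ _ Ua Ub) h /(EP _ _ Ub Uc) h'; apply/EP => //; rewrite h.
have clsP b b' (Ub : iU I b) (Ub' : iU I b') :
    cls E Ub = cls E Ub' <-> imu I b = imu I b'.
  by rewrite -EP // cls_eqP // => x y /qE_U[].
have [mubar hmubar] : exists mubar : Q -> A,
    forall b (Ub : iU I b), mubar (cls E Ub) = imu I b.
  have /choice[mubar h] : forall C : Q, exists a, forall b (Ub : iU I b),
      C = cls E Ub -> a = imu I b.
    move=> C; have [b [Ub ->]] := quotP C; exists (imu I b) => b' Ub'.
    by move=> /clsP.
  by exists mubar => b Ub; exact: h.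
have [inv invK] : exists inv : A -> Q, cancel inv mubar.
  suff /choice[inv h] : forall a, exists C, mubar C = a by exists inv.
  by move=> a; have [b Ub <-] := onto a; exists (cls E Ub).
have mubarK : cancel mubar inv.
  move=> C; have [b [Ub eC]] := quotP C; have [b' [Ub' e]] := quotP (inv (mubar C)).
  by rewrite e eC; apply/clsP; rewrite -(hmubar _ Ub) -(hmubar _ Ub') -e -eC invK.
have invE a b (Ub : iU I b) : cls E Ub = inv a <-> imu I b = a.
  by rewrite -(hmubar _ Ub); split=> [->|<-]; rewrite ?invK ?mubarK.
exists (@Ops LA Q (fun c => inv (icst A c))
  (fun f x => inv (ifun A (f := f) (mubar \o x)))
  (fun r x => irel A (r := r) (mubar \o x))); split=> //.
- split=> //; first by case: (carrier_inhabited A) => a; have [b] := onto a; exists b.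
  split=> /=.
  + move=> c b Ub; rewrite invE -hC //; exact: (@on_U_csat 1 _ (fun=> b)).
  + move=> f b Ub; rewrite invE; apply: (iff_trans (on_U_csat _ Ub)); rewrite hF //.
    rewrite (_ : mubar \o _ = (fun i => imu I (b (lift ord0 i)))); first by split.
    by apply: funext => i /=; rewrite hmubar.
  + move=> r b Ub; apply: (iff_trans (on_U_csat _ Ub)); rewrite hR //.
    by rewrite (_ : mubar \o _ = imu I \o b) //; apply: funext => i /=.
- exists mubar => //; split=> //=; first by exists inv.
Qed.

End InterpretationRepresents.

(** * Syntactic isomorphism and definable bijections *)

(** [m] turns the operations and relations of [A] into ones that are definable
    in [B] with parameters. *)
Definition definable_via LA LB (A : structure LA) (B : structure LB) (m : B -> A) :=
  exists k (G : code LA LB 1 k) (p : tup B k),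
    (forall b, code_U G p b) /\ represents G p (fun b => m (b ord0)).

Definition definably_bijective LA LB (A : structure LA) (B : structure LB) :=
  exists (m : B -> A) (m' : A -> B),
    [/\ cancel m m', cancel m' m, definable_via m & definable_via m'].

Section Composition.
Variables (LB LC : language) (B : structure LB) (C : structure LC).
Variables (d' k' : nat) (D : code LB LC d' k') (q : tup C k') (mu : tup C d' -> B).
Variables (d k : nat) (p : tup B k) (r : tup C (k * d' + k')).
Hypothesis r_q : forall i, r (rshift (k * d') i) = q i.
Let rp i : tup C d' := fun j => r (lshift k' (blk i j)).

Lemma comp_env n (c : tup (tup C (d * d')) n) :
  sumcase (fun ij => c ij.1 ij.2) r \o @comp_var d k d' k' n =
  env (sumcase (fun ij l => c ij.1 (blk ij.2 l)) rp) q.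
Proof. by apply: funext => -[[[[i j]|y] l]|y] /=. Qed.

Lemma csat_comp_U n (phi : formula LB ('I_n * 'I_d + 'I_k)%type) chi0 c :
  is_translation D phi chi0 -> csat r (rename (@comp_var d k d' k' n) chi0) c ->
  forall i j, code_U D q (fun l => c i (blk j l)).
Proof.
move=> [nf _ ->]; rewrite /csat /sat sat_rename comp_env sat_tr => -[h _] i j.
exact: (h (inl (i, j))).
Qed.

Hypothesis Dmu : represents D q mu.
Hypothesis rp_p : forall i, code_U D q (rp i) /\ mu (rp i) = p i.

(** The reduction theorem for [D], applied to a formula of another code.  The
    parameters of that code are variables of the formula; [mu] takes the first
    parameters of the composite code to them. *)
Lemma csat_comp n (phi : formula LB ('I_n * 'I_d + 'I_k)%type) chi0 c :
  is_translation D phi chi0 ->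
  csat r (rename (@comp_var d k d' k' n) chi0) c <->
  (forall i j, code_U D q (fun l => c i (blk j l))) /\
  csat p phi (fun i j => mu (fun l => c i (blk j l))).
Proof.
move=> hphi; rewrite /csat /sat sat_rename comp_env (reduction Dmu _ hphi).
rewrite (_ : mu \o _ = sumcase (fun ij => mu (fun l => c ij.1 (blk ij.2 l))) p).
  split=> -[h ?]; split=> //; first by move=> i j; exact: (h (inl (i, j))).
  by move=> [[i j]|i] /=; [exact: h|case: (rp_p i)].
by apply: funext => -[ij|i] //=; case: (rp_p i).
Qed.

End Composition.

Lemma realize_eq LA LB (B : structure LB) d k k' (G : code LA LB d k)
    (G' : code LA LB d k') (p : tup B k) (p' : tup B k') :
  (forall b, csat p (cU G) b <-> csat p' (cU G') b) ->
  (forall b, csat p (cE G) b <-> csat p' (cE G') b) ->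
  (forall c b, csat p (cC G c) b <-> csat p' (cC G' c) b) ->
  (forall f b, csat p (cF G f) b <-> csat p' (cF G' f) b) ->
  (forall r b, csat p (cR G r) b <-> csat p' (cR G' r) b) ->
  realize G p = realize G' p'.
Proof.
move=> hU hE hC hF hR; rewrite /realize.
have eU : code_U G p = code_U G' p' by apply: funext => b; apply: propext; exact: hU.
have on n phi phi' : (forall b, csat p phi b <-> csat p' phi' b) ->
    @on_U _ _ B _ _ G p n phi = @on_U _ _ B _ _ G' p' n phi'.
  by move=> h; apply: funext => b; apply: propext; rewrite /on_U /mkset eU h.
have -> : (fun c : csym LA => [set b | on_U G p (cC G c) (fun=> b)]) =
    fun c => [set b | on_U G' p' (cC G' c) (fun=> b)].
  by apply: funext => c; rewrite (on _ _ _ (hC c)).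
have -> : (fun f : fsym LA => on_U G p (cF G f)) = fun f => on_U G' p' (cF G' f).
  by apply: functional_extensionality_dep => f; exact: on.
have -> : (fun r : rsym LA => on_U G p (cR G r)) = fun r => on_U G' p' (cR G' r).
  by apply: functional_extensionality_dep => r; exact: on.
by rewrite eU (on _ _ _ hE).
Qed.

Lemma blk1E m (i : 'I_m) (j : 'I_1) : blk i j = cast_ord (esym (muln1 m)) i.
Proof. by apply: val_inj; rewrite /= ord1 muln1 addn0. Qed.

Lemma blk11 (i j : 'I_1) : blk i j = ord0.
Proof. by apply: val_inj; rewrite /= !ord1. Qed.

Lemma tup1E T (b b' : tup T 1) : b ord0 = b' ord0 -> b = b'.
Proof. by move=> e; apply: funext => i; rewrite ord1. Qed.

(** The identical interpretation has dimension one and domain [A].  A dimension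
    is a product, hence both factors are one; a translation requires that its
    variables range over the domain of the second code, so that this domain is
    everything. *)
Lemma syn_definably_bijective LA LB (A : structure LA) (B : structure LB) :
  syntactically_isomorphic A B -> definably_bijective A B.
Proof.
move=> [I [J [/interpretation_represents hI /interpretation_represents hJ
  [K hK eK] [K' hK' eK']]]].
have dims L L' (M : structure L) (N : structure L') (I1 : idata M N)
    (J1 : idata N M) K1 : is_comp I1 J1 K1 -> interp_eq K1 (id_idata M) ->
    idim I1 = 1 /\ idim J1 = 1.
  move=> [H [r [_ _ _ ->]]] [/(congr1 (@qdim _ _)) /= e _].
  by have /eqP := e; rewrite muln_eq1 => /andP[/eqP-> /eqP->].
have [dI dJ] := dims _ _ _ _ _ _ _ hK eK.
case: I J hI hJ hK hK' dI dJ => d k G p mu [d' k' D q mu'] /= hI hJ hK hK' dI dJ.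
subst d d'.
have total_inverse L L' (M : structure L) (N : structure L') k1 k2 (G1 : code L L' 1 k1)
    (G2 : code L' L 1 k2) p1 p2 (mu1 : tup N 1 -> M) (mu2 : tup M 1 -> N) K0 :
    is_comp (IData G1 p1 mu1) (IData G2 p2 mu2) K0 -> interp_eq K0 (id_idata M) ->
    (forall a, code_U G2 p2 a) /\ (forall a, mu1 (fun=> mu2 (fun=> a)) = a).
  move=> [H [r /= [[[chi0 htr hH] _ _ _ _] _ hr ->]]] [/= eq_real eq_mu].
  have /= e : existT (fun n => set (tup M n)) (1 * 1)
      (qU (realize H r)) = existT _ 1 (qU (realize (id_code L)
        (fun i : 'I_0 => False_rect M (notF (ltn_ord i))))).
    exact: (congr1 (fun q : qstruct L M => existT _ (qdim q) (qU q)) eq_real).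
  have /= eU := existT_inj e.
  have Ua (a : tup M 1) : code_U H r a by rewrite eU.
  split=> a.
    have := Ua a; rewrite /code_U /mkset hH => /(csat_comp_U hr htr)-/(_ ord0 ord0).
    by rewrite (_ : (fun l => _) = a) //; apply: funext => j; rewrite blk11 ord1.
  exact: (eq_mu (fun=> a) (fun=> a) (Ua _) erefl).
have [UJ mumu'] := total_inverse _ _ _ _ _ _ _ _ _ _ _ _ _ hK eK.
have [UI mu'mu] := total_inverse _ _ _ _ _ _ _ _ _ _ _ _ _ hK' eK'.
exists (fun b => mu (fun=> b)), (fun a => mu' (fun=> a)); split=> //.
- exists k, G, p; split=> //; rewrite (_ : (fun b => _) = mu) //.
  by apply: funext => b; congr mu; exact: tup1E.
- exists k', D, q; split=> //; rewrite (_ : (fun b => _) = mu') //.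
  by apply: funext => b; congr mu'; exact: tup1E.
Qed.

(** The composite code is evaluated with the reduction theorem for [D], then each
    of its symbols with [represents] for [G]; the two coordinate maps cancel. *)
Lemma definably_bijective_comp LA LB (A : structure LA) (B : structure LB)
    k k' (G : code LA LB 1 k) (D : code LB LA 1 k') p q (m : B -> A) (m' : A -> B) :
  cancel m m' -> cancel m' m ->
  (forall b, code_U G p b) -> (forall a, code_U D q a) ->
  represents G p (fun b => m (b ord0)) -> represents D q (fun a => m' (a ord0)) ->
  let I := @IData LA LB A B 1 k G p (fun b => m (b ord0)) in
  let J := @IData LB LA B A 1 k' D q (fun a => m' (a ord0)) in
  exists2 K, is_comp I J K & interp_eq K (id_idata A).
Proof.
move=> mK m'K UG UD hG hD I J.
pose T n (phi : formula LB ('I_n * 'I_1 + 'I_k)%type) :=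
  rename (@comp_var 1 k 1 k' n) (sval (cid (translation_exists D phi))).
have hT n (phi : formula LB ('I_n * 'I_1 + 'I_k)%type) :
    is_translation D phi (sval (cid (translation_exists D phi))).
  exact: svalP (cid _).
pose H : code LA LA 1 (k * 1 + k') := @Code LA LA 1 (k * 1 + k')
  (T 1 (cU G)) (T 2 (cE G)) (fun c => T 1 (cC G c))
  (fun f => T (far f).+1 (cF G f)) (fun r => T (rar r) (cR G r)).
pose r : tup A (k * 1 + k') := fun i =>
  match split i with inl y => m (p (cast_ord (muln1 k) y)) | inr y => q y end.
have r_q i : r (rshift (k * 1) i) = q i.
  by rewrite /r -[rshift _ _]/(unsplit (inr i)) unsplitK.
have r_p i j : r (lshift k' (blk i j)) = m (p i).
  rewrite /r -[lshift _ _]/(unsplit (inl (blk i j))) unsplitK blk1E.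
  by congr (m (p _)); apply: val_inj.
have csatT n phi c : csat r (T n phi) c <-> csat p phi (fun i _ => m' (c i ord0)).
  rewrite (csat_comp (p := p) r_q hD _ c (hT n phi)); last first.
    by move=> i; split; [exact: UD|rewrite /= r_p mK].
  rewrite (_ : (fun i j => _) = fun i _ => m' (c i ord0)); first by split=> [[]|].
  by apply: funext => i; apply: funext => j; rewrite blk11.
have [_ hE hC hF hR] := hG.
have real : realize H r = irealize (id_idata A).
  apply: realize_eq => /=.
  - move=> b; rewrite csatT; split=> // _.
    by have := UG (fun=> m' (b ord0 ord0)); congr csat; apply: tup1E.
  - move=> b; rewrite csatT.
    rewrite (_ : (fun i _ => _) = fun i : 'I_2 => if i == ord0 then
      fun=> m' (b ord0 ord0) else fun=> m' (b ord_max ord0)); last first.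
      apply: funext => -[[|[|//]] lt]; apply: funext => j; congr (m' (b _ _));
        exact: val_inj.
    by rewrite hE // !m'K.
  - move=> c b; rewrite csatT (_ : (fun i _ => _) = fun=> fun=> m' (b ord0 ord0)).
      by rewrite hC // m'K.
    exact: tup1E.
  - move=> f b; rewrite csatT hF // m'K /csat /sat /=.
    rewrite (_ : (fun i => m _) = fun i => b (lift ord0 i) ord0) //.
    by apply: funext => i; rewrite m'K.
  - move=> s b; rewrite csatT hR // /csat /sat /=.
    rewrite (_ : _ \o _ = fun i => b i ord0) //.
    by apply: funext => i; rewrite /= m'K.
exists (@IData LA LA A A (1 * 1) (k * 1 + k') H r
    (fun c => imu I (fun i => imu J (fun j => c (blk i j))))).
  exists H, r; split=> //.
    by split=> [||c|f|s]; eexists; try exact: hT.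
  by move=> i; split; [exact: UD|rewrite /= r_p mK].
split=> // b b' _ e; have <- : b = b' := existT_inj e.
by rewrite /= m'K blk11.
Qed.

Lemma definably_bijective_syn LA LB (A : structure LA) (B : structure LB) :
  definably_bijective A B -> syntactically_isomorphic A B.
Proof.
move=> [m [m' [mK m'K [k [G [p [UG hG]]]] [k' [D [q [UD hD]]]]]]].
exists (@IData LA LB A B 1 k G p (fun b => m (b ord0))),
  (@IData LB LA B A 1 k' D q (fun a => m' (a ord0))); split.
- exact: represents_interpretation.
- exact: represents_interpretation.
- exact: (definably_bijective_comp mK m'K UG UD hG hD).
- exact: (definably_bijective_comp m'K mK UD UG hD hG).
Qed.

(** * Pulling back quotients along a bijection *)

Section PullQuotient.
Variables (T T' : Type) (P : T' -> T) (P' : T -> T').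
Hypotheses (PK : cancel P P') (P'K : cancel P' P).

Definition pull_rel (R : T -> T -> Prop) (b b' : T') : Prop := R (P b) (P b').

Section OneSet.
Variables (X : set T) (R : T -> T -> Prop).

Lemma pull_quot_subproof (q : quot X R) :
  exists2 b, (P @^-1` X) b & P @^-1` (sval q) = [set b' | pull_rel R b b'].
Proof.
case: q => C [a Xa e]; exists (P' a); rewrite /= ?e /pull_rel /preimage /mkset P'K //.
Qed.

Definition pull_quot (q : quot X R) : quot (P @^-1` X) (pull_rel R) :=
  exist _ _ (pull_quot_subproof q).

Lemma push_quot_subproof (q : quot (P @^-1` X) (pull_rel R)) :
  exists2 a, X a & P' @^-1` (sval q) = [set a' | R a a'].
Proof.
case: q => C [b Xb e]; exists (P b) => //=.
by rewrite e; apply/seteqP; split=> a; rewrite /pull_rel /preimage /mkset /= P'K.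
Qed.

Definition push_quot (q : quot (P @^-1` X) (pull_rel R)) : quot X R :=
  exist _ _ (push_quot_subproof q).

Lemma pull_quotK : cancel pull_quot push_quot.
Proof.
case=> C h; apply: eq_exist => /=.
by apply/seteqP; split=> a /=; rewrite /preimage /mkset P'K.
Qed.

Lemma push_quotK : cancel push_quot pull_quot.
Proof.
case=> C h; apply: eq_exist => /=.
by apply/seteqP; split=> a /=; rewrite /preimage /mkset PK.
Qed.

Lemma pull_quot_cls b (Xb : X (P b)) (Xb' : (P @^-1` X) b) :
  pull_quot (cls R Xb) = cls (pull_rel R) Xb'.
Proof. exact: eq_exist. Qed.

Lemma push_quot_cls b (Xb : X (P b)) (Xb' : (P @^-1` X) b) :
  push_quot (cls (pull_rel R) Xb') = cls R Xb.
Proof. by rewrite -(pull_quot_cls Xb Xb') pull_quotK. Qed.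

End OneSet.
End PullQuotient.

Definition pull_map T T' S S' (P : T' -> T) (P' : T -> T') (P'K : cancel P' P)
    (Q : S' -> S) (Q' : S -> S') (Q'K : cancel Q' Q) X R Y R'
    (f : quot X R -> quot Y R') : quot (P @^-1` X) (pull_rel P R) ->
    quot (Q @^-1` Y) (pull_rel Q R') :=
  fun q => pull_quot Q'K (f (push_quot P'K q)).

(** Determines [pull_map f] without the inverses of [P] and [Q]. *)
Lemma pull_map_cls T T' S S' (P : T' -> T) (P' : T -> T') (P'K : cancel P' P)
    (Q : S' -> S) (Q' : S -> S') (Q'K : cancel Q' Q) X R Y R'
    (f : quot X R -> quot Y R') a (Xa : X (P a)) (Xa' : (P @^-1` X) a)
    b (Yb : Y (Q b)) (Yb' : (Q @^-1` Y) b) :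
  pull_map P'K Q'K f (cls (pull_rel P R) Xa') = cls (pull_rel Q R') Yb' <->
  f (cls R Xa) = cls R' Yb.
Proof.
rewrite /pull_map /= (push_quot_cls P'K _ Xa) -(pull_quot_cls Q'K _ Yb Yb').
by split=> [e|->//]; rewrite -[LHS](pull_quotK Q'K) e pull_quotK.
Qed.

(** * The translation functor of a definable bijection *)

Section BijectionFunctor.
Variables (LA LB : language) (A : structure LA) (B : structure LB).
Variables (m : B -> A) (m' : A -> B).
Hypotheses (mK : cancel m m') (m'K : cancel m' m).
Variables (k : nat) (G : code LA LB 1 k) (p : tup B k).
Hypotheses (UG : forall b, code_U G p b).
Hypotheses (hG : represents G p (fun b => m (b ord0))).

Let g (a : A) : tup B 1 := fun=> m' a.

(** The effect of [m] on tuples.  A translation multiplies the dimension by that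
    of the code, so the source has dimension [n * 1]. *)
Definition pull n (b : tup B (n * 1)) : tup A n := fun i => m (b (blk i ord0)).
Definition push n (a : tup A n) : tup B (n * 1) :=
  fun i => m' (a (cast_ord (muln1 n) i)).

Lemma pullK n : cancel (@pull n) (@push n).
Proof.
move=> b; apply: funext => i; rewrite /push /pull mK blk1E.
by congr b; apply: val_inj.
Qed.

Lemma pushK n : cancel (@push n) (@pull n).
Proof.
move=> a; apply: funext => i; rewrite /push /pull m'K blk1E.
by congr a; apply: val_inj.
Qed.

Lemma tr1_pull n (psi : aform A 'I_n) chi b : tr1 G p g psi chi ->
  asat chi b <-> asat psi (pull b).
Proof.
move=> h; rewrite (reduction_ext hG _ _ _ h) //.
by split=> [[_ k0]|k0]; [exact: k0|split].
Qed.

Lemma tr2_pull n s (psi : aform A ('I_n + 'I_s)) chi b c : tr2 G p g psi chi ->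
  asat2 chi b c <-> asat2 psi (pull b) (pull c).
Proof.
move=> h; rewrite /asat2 (reduction_ext hG _ _ _ h) //.
rewrite (_ : (fun v => _) = sumcase (pull b) (pull c)); first by split=> [[_ k0]|k0].
by apply: funext => -[].
Qed.

(** Translation defines preimages under [m]; F1-F7 all rest on this fact and its
    analogue [tr2_pull] for binary formulas. *)
Lemma Vset_pull n (S : set (aform A 'I_n)) T : trset G p g S T ->
  Vset T = @pull n @^-1` Vset S.
Proof.
move=> [tau htau ->]; apply/seteqP; split=> b.
  by move=> h psi Spsi; apply/(tr1_pull b (htau _ Spsi)); apply: h; exists psi.
by move=> h _ [psi Spsi <-]; apply/(tr1_pull b (htau _ Spsi)); exact: h.
Qed.

Lemma erel_pull n (E : aform A ('I_n + 'I_n)) E' (X : set (tup A n)) :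
  tr2 G p g E E' -> erel E' (@pull n @^-1` X) = pull_rel (@pull n) (erel E X).
Proof.
move=> h; apply: funext => b; apply: funext => b'; apply: propext.
rewrite /pull_rel /erel -(propext (tr2_pull b b' h)).
by [].
Qed.

Lemma induces_equiv_pull n (E : aform A ('I_n + 'I_n)) E' (X : set (tup A n)) :
  tr2 G p g E E' -> induces_equiv E X -> induces_equiv E' (@pull n @^-1` X).
Proof.
move=> h [[rE sE tE] cE]; split; last first.
  by move=> b b' Xb; rewrite !(tr2_pull _ _ h); exact: cE.
rewrite (erel_pull _ h); split=> [b|b b'|b b' b'']; rewrite /preimage /mkset /pull_rel.
- exact: rE.
- exact: sE.
- exact: tE.
Qed.

Lemma induces_map_pull n s (phi : aform A ('I_n + 'I_s)) phi' X R Y R'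
    (f : quot X R -> quot Y R') :
  tr2 G p g phi phi' -> induces_map phi f ->
  induces_map phi' (pull_map (@pushK n) (@pushK s) f).
Proof.
move=> h [f1 f2]; split=> [b c Xb Yc|b c Xb nYc].
  by rewrite (pull_map_cls _ _ f Xb Xb Yc Yc) f1 (tr2_pull _ _ h).
by rewrite (tr2_pull _ _ h); exact: f2.
Qed.

(** One lift of [f] serves all the formulas that induce [f]. *)
Lemma induces_map_pull_exists n s X R Y R' (f : quot X R -> quot Y R')
    (X1 : set (tup B (n * 1))) R1 (Y1 : set (tup B (s * 1))) R1' :
  X1 = @pull n @^-1` X -> R1 = pull_rel (@pull n) R ->
  Y1 = @pull s @^-1` Y -> R1' = pull_rel (@pull s) R' ->
  exists f' : quot X1 R1 -> quot Y1 R1',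
    forall (phi : aform A ('I_n + 'I_s)) phi',
    tr2 G p g phi phi' -> induces_map phi f -> induces_map phi' f'.
Proof.
move=> -> -> -> ->; exists (pull_map (@pushK n) (@pushK s) f) => phi phi'.
exact: induces_map_pull.
Qed.

Variable sc : size_class.

Lemma size_ok_image T T' (S : set T) (f : T -> T') :
  size_ok sc S -> size_ok sc (f @` S).
Proof. by case: sc => //=; exact: finite_image. Qed.

Section PullObject.
Variables (n : nat) (x : plset A sc n).

Lemma pull_nonempty : @pull n @^-1` oX x !=set0.
Proof.
by have [a Xa] := oX_nonempty x; exists (push a); rewrite /preimage /mkset pushK.
Qed.

Lemma pull_logical : logical sc (@pull n @^-1` oX x).
Proof.
have [S Sok ->] := oX_logical x; have [T hT] := trset_exists G p g S.
exists T; last by rewrite (Vset_pull hT).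
by case: hT => tau _ ->; exact: size_ok_image.
Qed.

Lemma pull_formula : exists2 E, induces_equiv E (@pull n @^-1` oX x) &
  pull_rel (@pull n) (@oR _ _ _ _ x) = erel E (@pull n @^-1` oX x).
Proof.
have [E hE ->] := oR_formula x.
have [E' hE'] : exists E', tr2 G p g E E' by exact: ext_translation_exists.
by exists E'; [exact: induces_equiv_pull hE|rewrite (erel_pull _ hE')].
Qed.

Definition pull_obj : plset B sc (n * 1) :=
  PLSet pull_nonempty pull_logical pull_formula.

End PullObject.

Section PullMorphism.
Variables (n s : nat) (x : plset A sc n) (y : plset A sc s) (f : fmap x y).

Lemma pull_fmap_subproof : exists phi, @induces_map _ B _ _ phi
  (oX (pull_obj x)) (@oR _ _ _ _ (pull_obj x))
  (oX (pull_obj y)) (@oR _ _ _ _ (pull_obj y))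
  (pull_map (@pushK n) (@pushK s) (sval f)).
Proof.
case: f => h [phi hphi].
have [phi' hphi'] : exists phi', tr2 G p g phi phi' by exact: ext_translation_exists.
by exists phi'; exact: induces_map_pull hphi.
Qed.

Definition pull_fmap : fmap (pull_obj x) (pull_obj y) :=
  exist _ _ pull_fmap_subproof.

End PullMorphism.

Definition bijection_obj (x : obj (PLS A sc)) : obj (PLS B sc) :=
  if x is Some x' then plob (pull_obj (projT2 x')) else None.

Definition bijection_hom (x y : obj (PLS A sc)) :
    hom x y -> hom (bijection_obj x) (bijection_obj y) :=
  match x, y return @hom (PLS A sc) x y ->
    @hom (PLS B sc) (bijection_obj x) (bijection_obj y) with
  | None, _ => fun=> tt
  | Some _, None => fun f => match f with end
  | Some x', Some y' => fun f => pull_fmap f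
  end.

Definition bijection_functor : functor (PLS A sc) (PLS B sc).
Proof.
refine (@Functor (PLS A sc) (PLS B sc) bijection_obj bijection_hom _ _).
- case=> [x|//]; apply: eq_exist; apply: funext => q.
  exact: (push_quotK (@pullK _)).
- move=> [x|] [y|] [z|] h f; try by [case: f|case: h].
  apply: eq_exist; apply: funext => q /=.
  by rewrite /pull_map /= pull_quotK.
Defined.

Lemma tr_presentation_pull n (S : set (aform A 'I_n)) E T E' :
  tr_presentation sc G p g S E T E' ->
  [/\ Vset T = @pull n @^-1` Vset S,
      erel E' (Vset T) = pull_rel (@pull n) (erel E (Vset S)),
      induces_equiv E' (Vset T), Vset T !=set0 & logical sc (Vset T)].
Proof.
move=> [[_ Sok] [a Va] hE hT hE']; have eT := Vset_pull hT.
split=> //; rewrite ?eT ?(erel_pull _ hE') //.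
- exact: induces_equiv_pull hE.
- by exists (push a); rewrite /preimage /mkset pushK.
- by exists T => //; case: hT => tau _ ->; exact: size_ok_image.
Qed.

Lemma bijection_functor_translation :
  is_translation_functor G p g bijection_functor.
Proof.
split.
- split.
  + move=> n S T _ /Vset_pull ->; split=> [->|/seteqP[h _]]; first exact: preimage_set0.
    apply/seteqP; split=> // a Sa; apply: (h (push a)).
    by rewrite /preimage /mkset pushK.
  + by move=> n S S' T T' _ _ /Vset_pull -> /Vset_pull -> ->.
  + by move=> n S E T E' /tr_presentation_pull[].
  + move=> n S T E1 E2 E1' E2' _ _ /Vset_pull -> h1 h2 [i1 i2 e].
    split; [exact: induces_equiv_pull i1|exact: induces_equiv_pull i2|].
    by rewrite (erel_pull _ h1) (erel_pull _ h2) e.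
- split.
  + move=> n S E T E' s S1 E1 T1 E1' phi phi' f.
    move=> /tr_presentation_pull[eT eE _ _ _] /tr_presentation_pull[eT1 eE1 _ _ _] h hf.
    have [f' hf'] := induces_map_pull_exists f eT eE eT1 eE1.
    by exists f'; exact: hf' hf.
  + move=> n S E T E' s S1 E1 T1 E1' phi phi' psi psi' f.
    move=> /tr_presentation_pull[eT eE _ _ _] /tr_presentation_pull[eT1 eE1 _ _ _].
    move=> h h' hf hf1; have [f' hf'] := induces_map_pull_exists f eT eE eT1 eE1.
    by exists f'; [exact: hf' hf|exact: hf' hf1].
  + move=> n S E T E' s S1 E1 T1 E1' r S2 E2 T2 E2' phi phi' psi psi' chi f h f' h'.
    move=> /tr_presentation_pull[_ _ i ne lg] /tr_presentation_pull[_ _ i1 ne1 lg1].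
    move=> /tr_presentation_pull[_ _ i2 ne2 lg2] hphi hpsi hchi _ _ hf' hh'.
    pose x := PLSet ne lg (ex_intro2 _ _ E' i erefl).
    pose x1 := PLSet ne1 lg1 (ex_intro2 _ _ E1' i1 erefl).
    pose x2 := PLSet ne2 lg2 (ex_intro2 _ _ E2' i2 erefl).
    have [c1 c2] := @induces_comp _ _ _ _ _ _ x x1 x2 f' h' _ _ hf' hh'.
    have e b c : asat2 chi b c <-> asat2 (comp_form phi' psi') b c.
      rewrite (tr2_pull _ _ hchi) !asat2_comp; split=> -[y].
        rewrite -(pushK y) -(tr2_pull _ _ hphi) -(tr2_pull _ _ hpsi).
        by exists (push y).
      rewrite (tr2_pull _ _ hphi) (tr2_pull _ _ hpsi).
      by exists (pull y).
    split=> [a c Xa Zc|a c Xa nZc]; rewrite e; [exact: c1|exact: c2].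
- by [].
- move=> n x S E T E' /tr_presentation_pull[eT eE _ _ _] eX eR.
  exists (pull_obj x); split=> //=; first by rewrite eX eT.
  by rewrite eR eE.
- move=> n s x y f phi phi' hf h.
  exists (pull_obj x), (pull_obj y), (pull_fmap f); split=> //.
  exact: induces_map_pull hf.
Qed.

Lemma bijection_functor_logical (x : obj (PLS A sc)) :
  is_logical_object x -> is_logical_object (bijection_functor x).
Proof.
case: x => //= -[n x] /= h a b Xa Xb; rewrite /pull_rel h //.
by split=> [/(can_inj (@pullK n))|->].
Qed.

End BijectionFunctor.

(** * Mutually inverse functors *)

Definition change_dim T n n' (e : n = n') (a : tup T n') : tup T n := a \o cast_ord e.

Lemma change_dim_erefl T n (e : n = n) (a : tup T n) : change_dim e a = a.
Proof. by apply: funext => i; rewrite /change_dim /= cast_ord_id. Qed.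

Section ChangeDimension.
Variables (L : language) (A : structure L) (sc : size_class).

Lemma plset_eq n (x y : plset A sc n) :
  oX x = oX y -> @oR _ _ _ _ x = @oR _ _ _ _ y -> x = y.
Proof.
case: x y => X R hX lX eX [X' R' hX' lX' eX'] /= eXX eRR; subst X' R'.
by congr PLSet; exact: Prop_irrelevance.
Qed.

(** Equality across the dimensions [n] and [n * 1 * 1], which are equal but not
    convertible. *)
Definition same_plset n n' (e : n = n') (x : plset A sc n) (x' : plset A sc n') :=
  (forall a, oX x' a <-> oX x (change_dim e a)) /\
  (forall a b, @oR _ _ _ _ x' a b <->
     @oR _ _ _ _ x (change_dim e a) (change_dim e b)).

Lemma same_plset_erefl n (e : n = n) (x x' : plset A sc n) :
  same_plset e x x' -> x = x'.
Proof.
move=> [eX eR]; apply: plset_eq.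
  by apply/seteqP; split=> a /=; rewrite eX change_dim_erefl.
by apply: funext => a; apply: funext => b; apply: propext;
  rewrite eR !change_dim_erefl.
Qed.

Lemma same_plset_eq n n' (e : n = n') (x : plset A sc n) (x' : plset A sc n') :
  same_plset e x x' -> plob x = plob x'.
Proof. by subst n'; move=> /same_plset_erefl ->. Qed.

(** A formula map is determined by which classes it relates, and this can be said
    without transporting it along equalities of objects. *)
Lemma same_fmap_arrow n n' s s' (en : n = n') (es : s = s')
    (x : plset A sc n) (x' : plset A sc n') (y : plset A sc s) (y' : plset A sc s')
    (f : fmap x y) (f' : fmap x' y') :
  same_plset en x x' -> same_plset es y y' ->
  (forall a b (Xa : oX x (change_dim en a)) (Xa' : oX x' a)
      (Yb : oX y (change_dim es b)) (Yb' : oX y' b),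
    sval f' (cls _ Xa') = cls _ Yb' <-> sval f (cls _ Xa) = cls _ Yb) ->
  @arrow (PLS A sc) (plob x) (plob y) f = @arrow (PLS A sc) (plob x') (plob y') f'.
Proof.
subst n' s' => /same_plset_erefl ex /same_plset_erefl ey; subst x' y' => h.
suff -> : f = f' by [].
case: f f' h => f hf [f' hf'] /= h; apply: eq_exist; apply: funext => q.
have [a [Xa ->]] := quotP q; have [b [Yb e]] := quotP (f (cls _ Xa)).
rewrite e; apply/esym.
have := h a b; rewrite !change_dim_erefl => /(_ Xa Xa Yb Yb) H.
exact/H.
Qed.

End ChangeDimension.

Section RoundTrip.
Variables (LA LB : language) (A : structure LA) (B : structure LB).
Variables (m : B -> A) (m' : A -> B).
Hypotheses (mK : cancel m m') (m'K : cancel m' m).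
Variables (k : nat) (G : code LA LB 1 k) (p : tup B k).
Hypotheses (UG : forall b, code_U G p b).
Hypotheses (hG : represents G p (fun b => m (b ord0))).
Variables (k' : nat) (D : code LB LA 1 k') (q : tup A k').
Hypotheses (UD : forall a, code_U D q a).
Hypotheses (hD : represents D q (fun a => m' (a ord0))).
Variable sc : size_class.

Let F := bijection_functor mK m'K UG hG sc.
Let F' := bijection_functor m'K mK UD hD sc.

Let dim2 n : n * 1 * 1 = n.
Proof. by rewrite !muln1. Qed.

Let pull_pull n (a : tup A (n * 1 * 1)) :
  pull m (pull m' a) = change_dim (esym (dim2 n)) a.
Proof.
apply: funext => i; rewrite /pull /change_dim /= m'K !blk1E.
by congr a; apply: val_inj.
Qed.

Let same_round n (x : plset A sc n) :
  same_plset (esym (dim2 n)) x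
    (pull_obj mK UD hD (pull_obj m'K UG hG x)).
Proof.
split=> [a|a b] /=; rewrite /pull_rel /preimage /mkset !pull_pull //.
Qed.

Lemma arrow_from_empty L (M : structure L) (y y' : obj (PLS M sc)) f f' :
  y = y' -> @arrow (PLS M sc) None y f = @arrow (PLS M sc) None y' f'.
Proof. by move=> <-; case: f; case: f'. Qed.

Lemma bijection_functorK : functor_eq (fcomp F' F) (fid (PLS A sc)).
Proof.
have eobj x : F' (F x) = x.
  by case: x => // -[n x]; apply/esym; exact: same_plset_eq (same_round x).
split=> // -[[n x]|] [[s y]|] f; try by case: f.
- apply/esym.
  apply: (same_fmap_arrow (same_round x) (same_round y)) => a b Xa Xa' Yb Yb'.
  have e1 : oX x (pull m (pull m' a)) by rewrite pull_pull.
  have e2 : oX y (pull m (pull m' b)) by rewrite pull_pull.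
  rewrite [sval _]/= (pull_map_cls _ _ _ (e1 : oX (pull_obj m'K UG hG x) (pull m' a)) _
    (e2 : oX (pull_obj m'K UG hG y) (pull m' b))).
  rewrite (pull_map_cls _ _ _ e1 _ e2).
  by move: e1 e2 Xa Yb; rewrite !pull_pull => e1 e2 Xa Yb;
    rewrite (Prop_irrelevance e1 Xa) (Prop_irrelevance e2 Yb).
- apply: (@arrow_from_empty _ A (F' (F (Some (existT _ s y)))) (Some (existT _ s y))).
  exact: eobj.
Qed.

End RoundTrip.

Section RestrictFunctor.
Variables (C D : category) (P : obj C -> Prop) (Q : obj D -> Prop).

Definition restrict_functor (F : functor C D) (PQ : forall x, P x -> Q (F x)) :
  functor (full_sub P) (full_sub Q) :=
  @Functor (full_sub P) (full_sub Q)
    (fun x => exist _ (F (sval x)) (PQ _ (svalP x)))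
    (fun x y f => @fhom _ _ F (sval x) (sval y) f)
    (fun x => fhom1 F (sval x))
    (fun x y z g f => @fhomM _ _ F (sval x) (sval y) (sval z) g f).

(** Objects of a full subcategory with the same underlying object are equal by
    proof irrelevance, so equality of arrows can be tested in the ambient
    category. *)
Lemma arrow_full_sub (x y x' y' : obj (full_sub P)) (f : hom x y) (f' : hom x' y') :
  @arrow C (sval x) (sval y) f = @arrow C (sval x') (sval y') f' ->
  arrow f = arrow f'.
Proof.
case: x y x' y' f f' => [x px] [y py] [x' px'] [y' py'] /= f f' e.
have [ex ey] : x = x' /\ y = y' by case: (projT1_eq e).
subst x' y'; move: px' py'.
by rewrite (existT_inj e) => px' py';
  rewrite (Prop_irrelevance px px') (Prop_irrelevance py py').
Qed.

End RestrictFunctor.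

Lemma restrict_functorK C D (P : obj C -> Prop) (Q : obj D -> Prop)
    (F : functor C D) (F' : functor D C) PQ QP :
  functor_eq (fcomp F' F) (fid C) ->
  functor_eq (fcomp (@restrict_functor D C Q P F' QP) (@restrict_functor C D P Q F PQ))
    (fid (full_sub P)).
Proof.
move=> [eo ea]; split=> [[x px]|x y f]; first by apply: eq_exist; exact: eo.
by apply: arrow_full_sub; exact: ea.
Qed.

(** An injective coordinate map identifies no two points, so that E may be
    replaced by equality. *)
Lemma definable_via_injective LA LB (A : structure LA) (B : structure LB)
    (m : B -> A) : injective m -> definable_via m ->
  exists k (G : code LA LB 1 k) (p : tup B k),
    [/\ injective_code G, forall b, code_U G p b &
        represents G p (fun b => m (b ord0))].
Proof.
move=> inj [k [G [p [UG [onto _ hC hF hR]]]]].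
pose E : formula LB (cvar 1 k 2) :=
  fands [seq Feq (Tvar (inl (ord0, j))) (Tvar (inl (ord_max, j))) | j <- enum 'I_1].
exists k, (@Code LA LB 1 k (cU G) E (cC G) (cF G) (cR G)), p; split=> //; split=> //.
move=> b b' _ _; rewrite /csat /sat /E sat_fands_enum /=.
by split=> [/(_ ord0) ->|/inj e j]; last rewrite ord1.
Qed.

Section BijectionIso.
Variables (LA LB : language) (A : structure LA) (B : structure LB).
Hypothesis AB : definably_bijective A B.
Variable sc : size_class.

Lemma definably_bijective_PLS :
  @iso_relative (PLS A sc) (PLS B sc) (@Tr LA LB A B sc) (@Tr LB LA B A sc).
Proof.
have [m [m' [mK m'K [k [G [p [UG hG]]]] [k' [D [q [UD hD]]]]]]] := AB.
exists (bijection_functor mK m'K UG hG sc), (bijection_functor m'K mK UD hD sc).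
split.
- do 5 eexists; exact: bijection_functor_translation.
- do 5 eexists; exact: bijection_functor_translation.
- exact: bijection_functorK.
- exact: bijection_functorK.
Qed.

Lemma definably_bijective_LS :
  @iso_relative (LS A sc) (LS B sc) (@Tr_inj LA LB A B sc) (@Tr_inj LB LA B A sc).
Proof.
have [m [m' [mK m'K dm dm']]] := AB.
have [k [G [p [injG UG hG]]]] := definable_via_injective (can_inj mK) dm.
have [k' [D [q [injD UD hD]]]] := definable_via_injective (can_inj m'K) dm'.
exists (restrict_functor (bijection_functor_logical mK m'K UG hG (sc := sc))),
  (restrict_functor (bijection_functor_logical m'K mK UD hD (sc := sc))).
split.
- do 6 eexists; split; [exact: injG|exact: bijection_functor_translation|by split].
- do 6 eexists; split; [exact: injD|exact: bijection_functor_translation|by split].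
- by apply: restrict_functorK; exact: bijection_functorK.
- by apply: restrict_functorK; exact: bijection_functorK.
Qed.

End BijectionIso.

(** * Recovering the bijection from the functors *)

Section AtomicTranslations.
Variables (LA LB : language) (A : structure LA) (B : structure LB) (d k : nat).
Variables (G : code LA LB d k) (p : tup B k) (g : A -> tup B d).

Lemma sat_uatom_rename V W (h : V -> W) (a : uatom LA V) (rho : W -> A) :
  sat_ops A (uatom_form (uatom_rename h a)) rho <-> sat_ops A (uatom_form a) (rho \o h).
Proof. by case: a. Qed.

Lemma uatom_csat_rename V W (h : V -> W) (a : uatom LA V) (bb : W -> tup B d) :
  uatom_csat G p (uatom_rename h a) bb <-> uatom_csat G p a (bb \o h).
Proof. by case: a. Qed.

(** An atom is its own normal form, so that one of its translations is explicit.
    The parameters occur in it as variables, hence are required to lie in the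
    domain of the code. *)
Lemma uatom_translation (V : finType) W (h : V * 'I_d -> W) s (a : tup A s)
    (al : uatom LA (V + 'I_s)) : injective a ->
  exists2 chi : aform B W,
    is_ext_translation G p g h (inst (name_params a) (uatom_form al)) chi &
    forall rho, let bb v : tup B d := fun j => rho (h (v, j)) in
      asat chi rho <->
      [/\ forall v, code_U G p (bb v), forall i, code_U G p (g (a i)) &
          uatom_csat G p al (sumcase bb (g \o a))].
Proof.
move=> ia; pose n : nform LA (V + 'I_s)%type := Nmat (((true, al), [::]), [::]).
eexists.
  exists s, a, (uatom_form al), (tr G n); split=> //; exists n => //; first by left.
move=> rho bb; rewrite /asat /sat sat_inst.
rewrite (_ : _ \o _ = env (sumcase bb (g \o a)) p); last by apply: funext => -[[[]]|].
rewrite sat_tr [nform_tr _ _]/= sat_uatom_tr.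
split=> [[U h1]|[U1 U2 h1]]; split=> //.
- by move=> v; exact: (U (inl v)).
- by move=> i; exact: (U (inr i)).
- by case.
Qed.

Definition noparam : tup A 0 := fun i => False_rect A (notF (ltn_ord i)).

Definition atom_form n (al : uatom LA 'I_n) : aform A 'I_n :=
  inst (name_params noparam) (uatom_form (uatom_rename inl al)).

Definition eq_form n (i : 'I_n) (c : A) : aform A 'I_n :=
  inst (name_params (fun=> c)) (uatom_form (Ueq LA (inl i) (inr (ord0 : 'I_1)))).

Lemma asat_atom n (al : uatom LA 'I_n) a :
  asat (atom_form al) a <-> sat_ops A (uatom_form al) a.
Proof. by rewrite /asat /sat sat_inst sat_uatom_rename. Qed.

Lemma asat_eq_form n i c (a : tup A n) : asat (eq_form i c) a <-> a i = c.
Proof. by []. Qed.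

Lemma tr1_atom n (al : uatom LA 'I_n) : exists2 chi, tr1 G p g (atom_form al) chi &
  forall b, let bb i : tup B d := fun j => b (blk i j) in
    asat chi b <-> (forall i, code_U G p (bb i)) /\ uatom_csat G p al bb.
Proof.
have i0 : injective noparam by case.
have [chi h1 h2] := uatom_translation (@blk1 n d) (uatom_rename inl al) i0.
exists chi => // b bb; rewrite h2.
split=> [[U _ /uatom_csat_rename]|[U h3]]; first by split.
by split=> //; [case|exact/uatom_csat_rename].
Qed.

Lemma tr1_eq_form n (i : 'I_n) c : exists2 chi, tr1 G p g (eq_form i c) chi &
  forall b, let bb i : tup B d := fun j => b (blk i j) in
    asat chi b <-> [/\ forall i, code_U G p (bb i), code_U G p (g c) &
      csat p (cE G) (fun z : 'I_2 => if z == ord0 then bb i else g c)].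
Proof.
have i1 : injective (fun _ : 'I_1 => c) by move=> x y _; rewrite !ord1.
have [chi h1 h2] := uatom_translation (@blk1 n d) (Ueq LA (inl i) (inr ord0)) i1.
exists chi => // b bb; rewrite h2 /=.
by split=> -[h3 h4 h5]; split=> //; exact: (h4 ord0).
Qed.

Variable sc : size_class.
Hypothesis hF2 : F2 (A := A) sc G p g.

Lemma system1 (L : language) (M : structure L) n (psi : aform M 'I_n) :
  system sc [set psi].
Proof.
split; first by exists psi.
by rewrite /size_ok; case: sc => //; exact: finite_set1.
Qed.

Lemma trset1 n (psi : aform A 'I_n) chi : tr1 G p g psi chi ->
  trset G p g [set psi] [set chi].
Proof. by move=> h; exists (fun=> chi); [move=> _ ->|rewrite image_set1]. Qed.

Lemma Vset1 (L : language) (M : structure L) n (psi : aform M 'I_n) a :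
  Vset [set psi] a <-> asat psi a.
Proof. by split=> [/(_ psi)|h _ ->] //; exact. Qed.

(** The set defined by a translated system does not depend on the choice of the
    translations. *)
Lemma Vset_trset n (S : set (aform A 'I_n)) T b : trset G p g S T ->
  Vset T b <-> forall psi chi, S psi -> tr1 G p g psi chi -> asat chi b.
Proof.
move=> [tau htau ->]; split=> [h psi chi Spsi hchi|h _ [psi Spsi <-]].
  apply/Vset1; rewrite -(hF2 (system1 psi) (system1 psi)
    (trset1 (htau _ Spsi)) (trset1 hchi) erefl).
  by apply/Vset1; apply: h; exists psi.
exact: h Spsi (htau _ Spsi).
Qed.

(** If [S] defines a subset of what [S'] defines, then [S] and its union with
    [S'] define the same set, and so do their translations by F2. *)
Lemma Vset_trset_sub n (S S' : set (aform A 'I_n)) T T' :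
  system sc S -> system sc S' -> trset G p g S T -> trset G p g S' T' ->
  Vset S `<=` Vset S' -> Vset T `<=` Vset T'.
Proof.
move=> sS sS' hT hT' SS' b Tb.
have sU : system sc (S `|` S').
  split; first by case: sS => -[psi] Spsi; exists psi; left.
  case: sS sS' => _ + [_]; rewrite /size_ok; case: sc => // fS fS'.
  by rewrite finite_setU.
have [U hU] := trset_exists G p g (S `|` S').
have eU : Vset (S `|` S') = Vset S.
  apply/seteqP; split=> a h psi; first by move=> Spsi; apply: h; left.
  by case=> [/h//|]; exact: (SS' _ h).
apply/(Vset_trset _ hT') => psi chi S'psi hchi.
have : Vset U b by rewrite (hF2 sU sS hU hT eU).
by move=> /(Vset_trset _ hU)/(_ psi chi); apply=> //; right.
Qed.

End AtomicTranslations.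

Lemma equality_form L (M : structure L) n : exists2 E : aform M ('I_n + 'I_n),
  (forall a b, asat2 E a b <-> a = b) & forall X, induces_equiv E X.
Proof.
pose E : aform M ('I_n + 'I_n) :=
  fands [seq Feq (Tvar (inl j)) (Tvar (inr j)) | j <- enum 'I_n].
have hE a b : asat2 E a b <-> a = b.
  rewrite /asat2 /asat /sat sat_fands_enum /=.
  by split=> [h|-> //]; apply: funext.
exists E => // X; split; first split=> [a Xa|a b Xa Xb|a b c Xa Xb Xc]; rewrite /erel.
- by split=> //; apply/hE.
- by move=> [_ _ /hE ->]; split=> //; apply/hE.
- by move=> [_ _ /hE ->] [_ _ /hE ->]; split=> //; apply/hE.
- by move=> a b Xa [] /hE; [move=> <-|move=> ->].
Qed.

Section FunctorRoundTrip.
Variables (LA LB : language) (A : structure LA) (B : structure LB) (sc : size_class).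
Variables (d k : nat) (G : code LA LB d k) (p : tup B k) (g : A -> tup B d).
Variables (d' k' : nat) (D : code LB LA d' k') (q : tup A k') (h : B -> tup A d').
Variables (F : functor (PLS A sc) (PLS B sc)) (F' : functor (PLS B sc) (PLS A sc)).
Hypothesis hF : is_translation_functor G p g F.
Hypothesis hF' : is_translation_functor D q h F'.
Hypothesis F'F : forall o, is_logical_object o -> F' (F o) = o.

(** The functors are evaluated at the logical set that [S] defines, with equality
    as its equivalence relation.  The first functor sends it to a quotient by
    the translation of equality, which has a translation in turn; the resulting
    object is the original one. *)
Lemma round_trip n (S : set (aform A 'I_n)) T T' :
  system sc S -> Vset S !=set0 -> trset G p g S T -> trset D q h T T' ->
  existT (fun n => set (tup A n)) (n * d * d') (Vset T') =
  existT (fun n => set (tup A n)) n (Vset S).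
Proof.
move=> sS nS hT hT'; have [E hE iE] := equality_form A n.
pose x := PLSet nS (ex_intro2 _ _ S sS.2 erefl) (ex_intro2 _ _ E (iE _) erefl).
have lx : is_logical_object (plob x).
  by move=> a b Xa Xb; split=> [[_ _ /hE]|] // ->; split=> //; apply/hE.
have [E' hE'] := ext_translation_exists G p g (@blk2 n n d) E.
have pS : tr_presentation sc G p g S E T E' by split.
have [[_ _ hF3 _] _ _ Fobj _] := hF; have [_ _ _ F'obj _] := hF'.
have [x' [Fx eX eR]] := Fobj _ x _ _ _ _ pS erefl erefl.
have [E'' hE''] := ext_translation_exists D q h (@blk2 (n * d) (n * d) d') E'.
have pT : tr_presentation sc D q h T E' T' E''.
  split=> //; last exact: hF3 pS.
    have [[psi Spsi] Sok] := sS; case: hT => tau _ ->.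
    by split; [exists (tau psi); exists psi|exact: size_ok_image].
  by rewrite -eX; exact: oX_nonempty.
have [x'' [F'x eX' _]] := F'obj _ x' _ _ _ _ pT eX eR.
have := F'F lx; rewrite Fx F'x => e.
pose carrier_of (o : plobj A sc) : {n & set (tup A n)} :=
  if o is Some y then existT _ (projT1 y) (oX (projT2 y)) else existT _ n (Vset S).
by have /= := congr1 carrier_of e; rewrite eX'.
Qed.

End FunctorRoundTrip.

Lemma block_tup1 T (b : tup T (1 * 1)) (i : 'I_1) : (fun j => b (blk i j)) = b.
Proof. by apply: funext => j; rewrite blk11 ord1. Qed.

Lemma system_trset L L' (M : structure L) (N : structure L') sc e l (C : code L L' e l)
    (c : tup N l) (u : M -> tup N e) n (S : set (aform M 'I_n)) T :
  system sc S -> trset C c u S T -> system sc T.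
Proof.
move=> [[psi Spsi] Sok] [tau _ ->].
by split; [exists (tau psi); exists psi|exact: size_ok_image].
Qed.

Section OneDimension.
Variables (LA LB : language) (A : structure LA) (B : structure LB) (sc : size_class).
Variables (k : nat) (G : code LA LB 1 k) (p : tup B k) (g : A -> tup B 1).
Variables (k' : nat) (D : code LB LA 1 k') (q : tup A k') (h : B -> tup A 1).
Hypotheses (F1G : F1 (A := A) sc G p g) (F2G : F2 (A := A) sc G p g).
Hypotheses (F1D : F1 (A := B) sc D q h) (F2D : F2 (A := B) sc D q h).
Hypothesis GD : forall (S : set (aform A 'I_1)) T T', system sc S ->
  Vset S !=set0 -> trset G p g S T -> trset D q h T T' -> Vset T' = Vset S.
Hypothesis DG : forall (S : set (aform B 'I_1)) T T', system sc S ->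
  Vset S !=set0 -> trset D q h S T -> trset G p g T T' -> Vset T' = Vset S.

(** The translation of [x = x] defines the whole of [B]: the universe of [B] is
    the translation of its own translation to [A], and the latter is contained in
    the universe of [A]. *)
Lemma universe_translation b :
  code_U G p b /\ csat p (cE G) (fun i : 'I_2 => if i == ord0 then b else b).
Proof.
pose topA := Ueq LA (ord0 : 'I_1) ord0; pose topB := Ueq LB (ord0 : 'I_1) ord0.
have [chi hchi chiE] := tr1_atom G p g topA.
have [T hT] := trset_exists D q h [set atom_form B topB].
have [T' hT'] := trset_exists G p g T.
have VB x : Vset [set atom_form B topB] x by apply/Vset1/asat_atom.
have VA x : Vset [set atom_form A topA] x by apply/Vset1/asat_atom.
have neB : Vset [set atom_form B topB] !=set0.
  by case: (carrier_inhabited B) => y; exists (fun=> y).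
have sT := system_trset (system1 sc _) hT.
have := Vset_trset_sub F2G sT (system1 sc (atom_form A topA)) hT' (trset1 hchi)
  (fun x _ => VA x).
rewrite (DG (system1 sc _) neB hT hT') => /(_ _ (VB b))/Vset1/chiE[].
by move=> /(_ ord0); rewrite /= block_tup1.
Qed.

Let UG b : code_U G p b := (universe_translation b).1.

(** The formula E with [g a] in the second place defines the same set as the
    translation of [x = a].  Let [b] be a point of this set.  Translating to [A]
    shows that [y = b] translates to a non-empty subset of the point [a], hence
    to the point itself.  Translating back, the point [b] is the whole set, which
    contains [g a]. *)
Lemma point_translation a b :
  csat p (cE G) (fun i : 'I_2 => if i == ord0 then b else g a) <-> b = g a.
Proof.
split=> [Eb|->]; last exact: (universe_translation (g a)).2.
have [chi hchi chiE] := tr1_eq_form G p g (ord0 : 'I_1) a.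
have chi_sat c : csat p (cE G) (fun i : 'I_2 => if i == ord0 then c else g a) ->
    Vset [set chi] c.
  by move=> h1; apply/Vset1/chiE; split=> //; rewrite block_tup1.
set Sa := [set eq_form (ord0 : 'I_1) a] in hchi *.
pose Sb := [set eq_form (ord0 : 'I_1) (b ord0)].
have VSa c : Vset Sa c <-> c = (fun=> a).
  rewrite Vset1 asat_eq_form; split=> [e|->//]; exact: tup1E.
have VSb c : Vset Sb c <-> c = b.
  rewrite Vset1 asat_eq_form; split=> [e|->//]; exact: tup1E.
have neSa : Vset Sa !=set0 by exists (fun=> a); exact/VSa.
have neSb : Vset Sb !=set0 by exists b; exact/VSb.
have sSa : system sc Sa := system1 sc _.
have sSb : system sc Sb := system1 sc _.
have sTa : system sc [set chi] := system1 sc _.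
have [Ta' hTa'] := trset_exists D q h [set chi].
have [Tb hTb] := trset_exists D q h Sb.
have [Tb' hTb'] := trset_exists G p g Tb.
have eTa := GD sSa neSa (trset1 hchi) hTa'.
have eTb := DG sSb neSb hTb hTb'.
have sub : Vset Tb `<=` Vset Sa.
  rewrite -eTa; apply: (Vset_trset_sub F2D sSb sTa hTb hTa') => c /VSb ->.
  exact: chi_sat.
have eTbSa : Vset Tb = Vset Sa.
  apply/seteqP; split=> // c /VSa ->.
  have /set0P[c' Tbc'] : Vset Tb != set0.
    by apply/eqP => /(F1D sSb hTb) e; move: neSb; rewrite e => -[].
  by have /VSa <- := sub _ Tbc'.
have e := F2G (system_trset sSb hTb) sSa hTb' (trset1 hchi) eTbSa.
apply/esym/VSb; rewrite -eTb e; apply: chi_sat.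
exact: (universe_translation (g a)).2.
Qed.

Lemma Vset_point_translation a T :
  trset G p g [set eq_form (ord0 : 'I_1) a] T -> forall b, Vset T b <-> b = g a.
Proof.
move=> hT b; have [chi hchi chiE] := tr1_eq_form G p g (ord0 : 'I_1) a.
rewrite (F2G (system1 sc _) (system1 sc _) hT (trset1 hchi) erefl) Vset1 chiE.
rewrite block_tup1.
by split=> [[_ _ /point_translation]|/point_translation].
Qed.

(** An atomic formula holds at a point exactly when it has a common solution
    with the equations that define the point. *)
Lemma atom_translation n (al : uatom LA 'I_n) (a : tup A n) :
  uatom_csat G p al (g \o a) <-> sat_ops A (uatom_form al) a.
Proof.
pose S : set (aform A 'I_n) :=
  [set atom_form A al] `|` range (fun i => eq_form i (a i)).
have sS : system sc S.
  split; first by exists (atom_form A al); left.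
  rewrite /size_ok; case: sc => //; rewrite finite_setU; split.
    exact: finite_set1.
  by apply: finite_image; exact: finite_finset.
have [T hT] := trset_exists G p g S.
have VS x : Vset S x <-> sat_ops A (uatom_form al) a /\ x = a.
  split=> [hx|[ha ->] _ [->|[i _ <-]] //]; last exact/asat_atom.
  have e : x = a.
    by apply: funext => i; apply: (hx (eq_form i (a i))); right; exists i.
  by split=> //; rewrite -e; apply/asat_atom; apply: hx; left.
have VT b : Vset T b <->
    uatom_csat G p al (g \o a) /\ forall i, (fun j => b (blk i j)) = g (a i).
  rewrite (Vset_trset F2G _ hT).
  have [chi hchi chiE] := tr1_atom G p g al.
  split=> [hb|[hal hb] psi chi' Spsi hchi'].
    have hbi i : (fun j => b (blk i j)) = g (a i).
      have [chii hchii chiiE] := tr1_eq_form G p g i (a i).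
      apply/point_translation.
      by have /chiiE[] : asat chii b by apply: hb hchii; right; exists i.
    split=> //; have /chiE[_] : asat chi b by apply: hb hchi; left.
    by rewrite (_ : (fun i j => _) = g \o a) //; apply: funext.
  have ebb : (fun i j => b (blk i j)) = g \o a by apply: funext.
  case: Spsi hchi' => [->|[i _ <-]] hchi'.
    apply/Vset1; rewrite -(F2G (system1 sc _) (system1 sc _) (trset1 hchi)
      (trset1 hchi') erefl).
    by apply/Vset1/chiE; split=> //; rewrite ebb.
  have [chii hchii chiiE] := tr1_eq_form G p g i (a i).
  apply/Vset1; rewrite -(F2G (system1 sc _) (system1 sc _) (trset1 hchii)
    (trset1 hchi') erefl).
  by apply/Vset1/chiiE; split=> //; exact/point_translation.
have F1S := F1G sS hT; split=> hal; apply: contrapT => nal.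
  have eS : Vset S = set0 by apply/seteqP; split=> x // /VS[].
  have eT := F1S.1 eS.
  have : Vset T (fun i => g (a (cast_ord (muln1 n) i)) ord0).
    apply/VT; split=> // i; apply: tup1E; rewrite blk1E.
    by congr (g (a _) _); apply: val_inj.
  by rewrite eT.
have eT : Vset T = set0 by apply/seteqP; split=> x // /VT[].
have : Vset S a by apply/VS.
by rewrite (F1S.2 eT).
Qed.

End OneDimension.

Section MutualTranslations.
Variables (LA LB : language) (A : structure LA) (B : structure LB) (sc : size_class).
Variables (k : nat) (G : code LA LB 1 k) (p : tup B k) (g : A -> tup B 1).
Variables (k' : nat) (D : code LB LA 1 k') (q : tup A k') (h : B -> tup A 1).
Hypotheses (F1G : F1 (A := A) sc G p g) (F2G : F2 (A := A) sc G p g).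
Hypotheses (F1D : F1 (A := B) sc D q h) (F2D : F2 (A := B) sc D q h).
Hypothesis GD : forall (S : set (aform A 'I_1)) T T', system sc S ->
  Vset S !=set0 -> trset G p g S T -> trset D q h T T' -> Vset T' = Vset S.
Hypothesis DG : forall (S : set (aform B 'I_1)) T T', system sc S ->
  Vset S !=set0 -> trset D q h S T -> trset G p g T T' -> Vset T' = Vset S.

(** The points [a] and [g a] are translations of each other. *)
Lemma point_maps_cancel : cancel (fun a => g a ord0) (fun b => h b ord0).
Proof.
move=> a; set b := g a ord0.
have [T hT] := trset_exists G p g [set eq_form (ord0 : 'I_1) a].
have [T' hT'] := trset_exists D q h T.
have [U hU] := trset_exists D q h [set eq_form (ord0 : 'I_1) b].
have VT := Vset_point_translation F2G F1D F2D GD DG hT.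
have VU := Vset_point_translation F2D F1G F2G DG GD hU.
have ne : Vset [set eq_form (ord0 : 'I_1) a] !=set0.
  by exists (fun=> a); apply/Vset1/asat_eq_form.
have eT : Vset T = Vset [set eq_form (ord0 : 'I_1) b].
  apply/seteqP; split=> c; first by move=> /VT ->; exact/Vset1/asat_eq_form.
  by move=> /Vset1/asat_eq_form e; apply/VT/tup1E.
have sT := system_trset (system1 sc _) hT.
have eU := F2D sT (system1 sc _) hT' hU eT.
have : Vset U (h b) by apply/VU.
by rewrite -eU (GD (system1 sc _) ne hT hT') => /Vset1/asat_eq_form.
Qed.

(** Each clause of [represents] is [atom_translation] for one kind of atom, because
    [g] takes the value of the coordinate map at a point back to that point. *)
Lemma point_maps_definable : cancel (fun b => h b ord0) (fun a => g a ord0) ->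
  definable_via (A := A) (B := B) (fun b => h b ord0).
Proof.
move=> hg.
have UG b : code_U G p b := (universe_translation F2G DG b).1.
have gh n (bb : 'I_n -> tup B 1) : (fun i => g (h (bb i ord0) ord0)) = bb.
  by apply: funext => i; apply: tup1E; rewrite hg.
have atom := atom_translation F1G F2G F1D F2D GD DG.
exists k, G, p; split=> //; split.
- by move=> a; exists (g a) => //; exact: point_maps_cancel.
- move=> b b' _ _; pose bb := fun i : 'I_2 => if i == ord0 then b else b'.
  have := atom 2 (Ueq LA ord0 ord_max) (fun i => h (bb i ord0) ord0).
  by rewrite /comp gh.
- move=> c b _; have := atom 1 (Ucst ord0 c) (fun i => h (b ord0) ord0).
  by rewrite /comp (gh 1 (fun=> b)).
- move=> f b _; have := atom _ (Ufun (f := f) id) (fun i => h (b i ord0) ord0).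
  by rewrite /comp gh.
- move=> r b _; have := atom _ (Urel (r := r) id) (fun i => h (b i ord0) ord0).
  by rewrite /comp gh.
Qed.

End MutualTranslations.

(** The universe of [A] has dimension one and is fixed by the composite functor,
    so that the product of the dimensions of the codes is one. *)
Lemma functors_definably_bijective LA LB (A : structure LA) (B : structure LB)
    (sc : size_class) d k (G : code LA LB d k) p g d' k' (D : code LB LA d' k') q h
    (F : functor (PLS A sc) (PLS B sc)) (F' : functor (PLS B sc) (PLS A sc)) :
  is_translation_functor G p g F -> is_translation_functor D q h F' ->
  (forall o, is_logical_object o -> F' (F o) = o) ->
  (forall o, is_logical_object o -> F (F' o) = o) ->
  definably_bijective A B.
Proof.
move=> hF hF' F'F FF'.
have [d1 d'1] : d = 1 /\ d' = 1.
  pose top := atom_form A (Ueq LA (ord0 : 'I_1) ord0).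
  have ne : Vset [set top] !=set0.
    case: (carrier_inhabited A) => a; exists (fun=> a); exact/Vset1/asat_atom.
  have [T hT] := trset_exists G p g [set top].
  have [T' hT'] := trset_exists D q h T.
  have /projT1_eq /= := round_trip hF hF' F'F (system1 sc _) ne hT hT'.
  by rewrite mul1n => /eqP; rewrite muln_eq1 => /andP[/eqP-> /eqP->].
subst d d'.
have [[F1G F2G _ _] _ _ _ _] := hF; have [[F1D F2D _ _] _ _ _ _] := hF'.
have GD (S : set (aform A 'I_1)) T T' : system sc S -> Vset S !=set0 ->
    trset G p g S T -> trset D q h T T' -> Vset T' = Vset S.
  by move=> sS ne hT hT'; exact: existT_inj (round_trip hF hF' F'F sS ne hT hT').
have DG (S : set (aform B 'I_1)) T T' : system sc S -> Vset S !=set0 ->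
    trset D q h S T -> trset G p g T T' -> Vset T' = Vset S.
  by move=> sS ne hT hT'; exact: existT_inj (round_trip hF' hF FF' sS ne hT hT').
have gh := point_maps_cancel F1G F2G F1D F2D GD DG.
have hg := point_maps_cancel F1D F2D F1G F2G DG GD.
exists (fun b => h b ord0), (fun a => g a ord0); split=> //.
  exact: (point_maps_definable F1G F2G F1D F2D GD DG).
exact: (point_maps_definable F1D F2D F1G F2G DG GD).
Qed.

Lemma PLS_definably_bijective LA LB (A : structure LA) (B : structure LB) sc :
  @iso_relative (PLS A sc) (PLS B sc) (@Tr LA LB A B sc) (@Tr LB LA B A sc) ->
  definably_bijective A B.
Proof.
move=> [F [F' [[d [k [G [p [g hF]]]]] [d' [k' [D [q [h hF']]]]] [e _] [e' _]]]].
by apply: (functors_definably_bijective hF hF') => o _; [exact: e|exact: e'].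
Qed.

Lemma LS_definably_bijective LA LB (A : structure LA) (B : structure LB) sc :
  @iso_relative (LS A sc) (LS B sc) (@Tr_inj LA LB A B sc) (@Tr_inj LB LA B A sc) ->
  definably_bijective A B.
Proof.
move=> [H [H' [[d [k [G [p [g [F [_ hF [HF _]]]]]]]] T' [e _] [e' _]]]].
have [d' [k' [D [q [h [F' [_ hF' [HF' _]]]]]]]] := T'.
apply: (functors_definably_bijective hF hF') => o lo.
- have /(congr1 sval) /= := e (exist _ o lo).
  have /= := HF (exist _ o lo) => <-.
  by have /= := HF' (H (exist _ o lo)) => <-.
- have /(congr1 sval) /= := e' (exist _ o lo).
  have /= := HF' (exist _ o lo) => <-.
  by have /= := HF (H' (exist _ o lo)) => <-.
Qed.

Theorem theorem14 (LA LB : language) (A : structure LA) (B : structure LB) :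
  [<-> syntactically_isomorphic A B;
       @iso_relative (DS A) (DS B)
         (@Tr_inj LA LB A B Finite_systems) (@Tr_inj LB LA B A Finite_systems);
       @iso_relative (LS A All_systems) (LS B All_systems)
         (@Tr_inj LA LB A B All_systems) (@Tr_inj LB LA B A All_systems);
       @iso_relative (PDS A) (PDS B)
         (@Tr LA LB A B Finite_systems) (@Tr LB LA B A Finite_systems);
       @iso_relative (PLS A All_systems) (PLS B All_systems)
         (@Tr LA LB A B All_systems) (@Tr LB LA B A All_systems)].
Proof.
tfae.
- by move=> /syn_definably_bijective/definably_bijective_LS; exact.
- by move=> /LS_definably_bijective/definably_bijective_LS; exact.
- by move=> /LS_definably_bijective/definably_bijective_PLS; exact.
- by move=> /PLS_definably_bijective/definably_bijective_PLS; exact.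
- by move=> /PLS_definably_bijective; exact: definably_bijective_syn.
Qed.
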